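(* Let $\Omega_\xi\subset\mathbb{R}^3$ be a bounded domain, $0<T\le\infty$, $\Omega_T=\Omega_\xi\times(0,T)$. For $t\in(0,T)$ let $\sigma(\cdot,t)\in H^1(\Omega_\xi;\mathrm{Sym}(3))$ and $W(\cdot,t)\in H^1(\Omega_\xi;\mathfrak{so}(3))$ be given, and assume that $\mathbb{H}^{\mathrm{ZJ}}$ satisfies the positive definiteness condition: there is a constant $c_0>0$, independent of the stress, with $$\langle\mathbb{H}^{\mathrm{ZJ}}(\sigma).D,D\rangle\ge c_0\|D\|^2\qquad\text{for all }D\in\mathrm{Sym}(3).$$ Then $\mathbb{A}(\sigma).v:=-\mathrm{Div}_\xi[\mathbb{H}^{\mathrm{ZJ}}(\sigma).\mathrm{sym}\,\mathrm{D}_\xi v]$ defines a strictly monotone operator $v\mapsto\mathbb{A}(\sigma).v$ on $H^1_0(\Omega_\xi;\mathbb{R}^3)$, i.e. $\langle\langle v_1-v_2,\mathbb{A}(\sigma).v_1-\mathbb{A}(\sigma).v_2\rangle\rangle>0$ for all $v_1\ne v_2$ in $H^1_0(\Omega_\xi;\mathbb{R}^3)$. Moreover, for given $g\in L^2(\Omega_T;\mathbb{R}^3)$ and a.e. $t\in(0,T)$, there exists a unique solution $v\in H^1_0(\Omega_\xi;\mathbb{R}^3)$ of $$-\mathrm{Div}_\xi\big[\mathbb{H}^{\mathrm{ZJ}}(\sigma(\xi,t)).\mathrm{sym}\,\mathrm{D}_\xi v\big]=g(\xi,t)\qquad\text{in }\Omega_\xi.$$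
   Context: $\mathrm{Sym}(3)$ is the space of real symmetric $3\times3$ matrices, $\mathfrak{so}(3)$ that of skew-symmetric ones, with Frobenius inner product $\langle X,Y\rangle=\mathrm{tr}(XY^T)$ and norm $\|X\|$. $\mathbb{H}^{\mathrm{ZJ}}:\mathrm{Sym}(3)\to\mathrm{Lin}(\mathrm{Sym}(3),\mathrm{Sym}(3))$ is a smooth map (a fourth-order tangent stiffness tensor with minor symmetry depending on the stress); $\mathbb{H}^{\mathrm{ZJ}}(\sigma).D$ denotes its action on $D\in\mathrm{Sym}(3)$. $\mathrm{D}_\xi v$ is the Jacobian matrix, $\mathrm{sym}\,X=\frac12(X+X^T)$, and $\mathrm{Div}_\xi$ of a matrix field is the row-wise divergence, understood weakly. $\langle\langle w,w^*\rangle\rangle$ is the duality pairing of $w\in H^1_0(\Omega_\xi;\mathbb{R}^3)$ and $w^*\in H^{-1}(\Omega_\xi;\mathbb{R}^3)$. As part of the setting, for the given $\sigma=\sigma(\cdot,t)$ the expression $\mathbb{A}(\sigma).v=-\mathrm{Div}_\xi[\mathbb{H}^{\mathrm{ZJ}}(\sigma).\mathrm{sym}\,\mathrm{D}_\xi v]$ is taken to define a linear operator $\mathbb{A}(\sigma):H^1_0(\Omega_\xi;\mathbb{R}^3)\to H^{-1}(\Omega_\xi;\mathbb{R}^3)$, acting by $\langle\langle w,\mathbb{A}(\sigma).v\rangle\rangle=\int_{\Omega_\xi}\langle\mathbb{H}^{\mathrm{ZJ}}(\sigma).\mathrm{sym}\,\mathrm{D}_\xi v,\mathrm{D}_\xi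 w\rangle\,\mathrm{d}\xi$. Solutions are understood in the sense of $\mathbb{A}(\sigma(\cdot,t)).v=g(\cdot,t)$ in $H^{-1}(\Omega_\xi;\mathbb{R}^3)$. (In the application, $-g=\mathrm{Div}_\xi(\sigma L^T-\mathrm{tr}(D)\sigma+\sigma W-W\sigma)+\mathrm{tr}(D)f+\frac{\mathrm{D}}{\mathrm{D}t}[f]$ with $L$ the velocity gradient, $D=\mathrm{sym}\,L$ and $f$ the body force, evaluated on given data; here $g$ is simply a given function.) *)

(* Defs.v *)
From HB Require Import structures.
From mathcomp Require Import all_boot all_order all_algebra.
From mathcomp Require Import all_classical all_reals all_analysis.

Set Implicit Arguments.
Unset Strict Implicit.
Unset Printing Implicit Defensive.
Import Order.TTheory GRing.Theory Num.Theory.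
Import numFieldNormedType.Exports.

Local Open Scope classical_set_scope.
Local Open Scope ring_scope.

(* Euclidean space as an iterated product of lines, so that it carries both the
   product normed-module structure (the max norm, which is equivalent to the
   Euclidean one) and the Borel sigma-algebra. *)
Notation R3 R :=
  (measurableTypeR R * measurableTypeR R * measurableTypeR R)%type.

Definition leb3 (R : realType) : {measure set (R3 R) -> \bar R} :=
  (@lebesgue_measure R \x @lebesgue_measure R \x @lebesgue_measure R)%E.

Definition basis3 (R : realType) (j : 'I_3) : R3 R :=
  ((j == 0%N :> nat)%:R, (j == 1%N :> nat)%:R, (j == 2%N :> nat)%:R).

Definition is_domain (R : realType) (Om : set (R3 R)) : Prop :=
  [/\ open Om, connected Om & Om !=set0].

Section matrices.
Variable R : realType.

Definition frob m n (X Y : 'M[R]_(m, n)) : R := \tr (X *m Y^T).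

Definition fnorm m n (X : 'M[R]_(m, n)) : R := Num.sqrt (frob X X).

Definition sympart (X : 'M[R]_3) : 'M[R]_3 := 2^-1 *: (X + X^T).

End matrices.

Section smoothness.
Variables (R : realType) (V W : normedModType R).

Fixpoint iterD (s : seq V) (f : V -> W) : V -> W :=
  if s is v :: s' then 'D_v (iterD s' f) else f.

(* On a finite-dimensional V this is the usual notion of a C^oo map. *)
Definition Cinfty (f : V -> W) : Prop :=
  forall s : seq V,
    (forall x v, derivable (iterD s f) x v) /\ continuous (iterD s f).

End smoothness.

(* A smooth map from Sym(3) to Lin(Sym(3), Sym(3)), represented by a total
   function of which only the values at symmetric arguments matter.  A map on
   the subspace Sym(3) is smooth iff its composite with the linear retraction
   sympart of 'M_3 onto Sym(3) is smooth. *)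
Definition stiffness_map (R : realType)
    (H : 'M[R]_3 -> 'M[R]_3 -> 'M[R]_3) : Prop :=
  [/\ forall s D, s \is symmetricmx -> D \is symmetricmx ->
        H s D \is symmetricmx,
      forall s a D E, s \is symmetricmx ->
        D \is symmetricmx -> E \is symmetricmx ->
        H s (a *: D + E) = a *: H s D + H s E
    & forall D, D \is symmetricmx ->
        Cinfty (fun X : 'M[R]_3 => H (sympart X) D)].

Definition positive_definite (R : realType)
    (H : 'M[R]_3 -> 'M[R]_3 -> 'M[R]_3) : Prop :=
  exists c0 : R, 0 < c0 /\
    forall s D, s \is symmetricmx -> D \is symmetricmx ->
      c0 * fnorm D ^+ 2 <= frob (H s D) D.

Section L2.
Context d (T : measurableType d) (R : realType).
Variables (mu : {measure set T -> \bar R}) (D : set T).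

Definition L2 (f : T -> R) : Prop := f \_ D \in Lfun mu 2%:E.

Definition L2mx m n (f : T -> 'M[R]_(m, n)) : Prop :=
  forall i j, L2 (fun x => f x i j).

End L2.

(* Elements of all the function spaces below are functions defined on the whole
   space, of which only the values on Om matter, up to equality almost
   everywhere in Om. *)
Section sobolev.
Variables (R : realType) (Om : set (R3 R)).

Definition testfun (phi : R3 R -> R) : Prop :=
  [/\ Cinfty phi, compact (closure [set x | phi x != 0])
    & closure [set x | phi x != 0] `<=` Om].

Definition is_wpartial (j : 'I_3) (u g : R3 R -> R) : Prop :=
  L2 (leb3 R) Om g /\
  forall phi, testfun phi ->
    \int[leb3 R]_(x in Om) (u x * 'D_(basis3 R j) phi x) =
    - \int[leb3 R]_(x in Om) (g x * phi x).

(* Weak derivatives are unique up to equality almost everywhere in Om, so the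
   choice of a representative is immaterial. *)
Definition wpartial (j : 'I_3) (u : R3 R -> R) : R3 R -> R :=
  xget (fun=> 0) [set g | is_wpartial j u g].

Definition H1 (u : R3 R -> R) : Prop :=
  L2 (leb3 R) Om u /\ forall j, exists g, is_wpartial j u g.

Definition H1mx m n (u : R3 R -> 'M[R]_(m, n)) : Prop :=
  forall i j, H1 (fun x => u x i j).

Definition Jac (v : R3 R -> 'cV[R]_3) (x : R3 R) : 'M[R]_3 :=
  \matrix_(i, j) wpartial j (fun y => v y i 0) x.

Definition H1norm (v : R3 R -> 'cV[R]_3) : R :=
  Num.sqrt (\int[leb3 R]_(x in Om) (fnorm (v x) ^+ 2) +
            \int[leb3 R]_(x in Om) (fnorm (Jac v x) ^+ 2)).

Definition H10 (v : R3 R -> 'cV[R]_3) : Prop :=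
  H1mx v /\
  forall e : R, 0 < e -> exists phi : R3 R -> 'cV[R]_3,
    (forall i, testfun (fun x => phi x i 0)) /\
    H1norm (fun x => v x - phi x) < e.

(* Candidates for elements of H^-1, the dual of H10: real-valued maps of which
   only the values on H10 matter. *)
Definition functional : Type := (R3 R -> 'cV[R]_3) -> R.

Definition Hm1 (l : functional) : Prop :=
  (forall a w1 w2, H10 w1 -> H10 w2 ->
     l (fun x => a *: w1 x + w2 x) = a * l w1 + l w2) /\
  exists C : R, forall w, H10 w -> `|l w| <= C * H1norm w.

Definition eqHm1 (l1 l2 : functional) : Prop :=
  forall w, H10 w -> l1 w = l2 w.

Definition pairing (w : R3 R -> 'cV[R]_3) (l : functional) : R := l w.

Definition strictly_monotone (A : (R3 R -> 'cV[R]_3) -> functional) : Prop :=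
  forall v1 v2, H10 v1 -> H10 v2 -> ~ (v1 = v2 %[ae leb3 R in Om]) ->
    0 < pairing (fun x => v1 x - v2 x) (fun w => A v1 w - A v2 w).

Definition wDiv (S : R3 R -> 'M[R]_3) : functional :=
  fun w => - \int[leb3 R]_(x in Om) frob (S x) (Jac w x).

Definition L2functional (f : R3 R -> 'cV[R]_3) : functional :=
  fun w => \int[leb3 R]_(x in Om) frob (f x) (w x).

Variables (H : 'M[R]_3 -> 'M[R]_3 -> 'M[R]_3) (sigma : R3 R -> 'M[R]_3).

Definition opA (v : R3 R -> 'cV[R]_3) : functional :=
  fun w => - wDiv (fun x => H (sigma x) (sympart (Jac v x))) w.

(* Integrability is required explicitly because \int is total: without it the
   formula for opA v w would be meaningless.  Each opA v is a bounded functional,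
   but boundedness of the operator v |-> opA v is not required. *)
Definition opA_linear_operator : Prop :=
  [/\ forall v w, H10 v -> H10 w ->
        (leb3 R).-integrable Om (fun x =>
          (frob (H (sigma x) (sympart (Jac v x))) (Jac w x))%:E),
      forall v, H10 v -> Hm1 (opA v)
    & forall a v1 v2, H10 v1 -> H10 v2 ->
        eqHm1 (opA (fun x => a *: v1 x + v2 x))
              (fun w => a * opA v1 w + opA v2 w)].

Definition weak_solution (f v : R3 R -> 'cV[R]_3) : Prop :=
  H10 v /\ eqHm1 (opA v) (L2functional f).

End sobolev.

Definition time_interval (R : realType) (T : \bar R) : set R :=
  [set t : R | 0 < t /\ (t%:E < T)%E].

(* Main.v *)
(* The bilinear form a(v, w) = <<w, A(sigma) v>> is coercive on H^1_0: for test
   functions Korn's inequality |Dv|^2 <= 2 |sym Dv|^2 and Poincare's inequality (in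
   L^2 norms) follow from integration by parts, and both pass to the closure.
   Coercivity yields strict monotonicity and uniqueness.

   For existence, v |-> A(sigma) v is not known to be bounded, so that Lax-Milgram
   does not apply as it stands.  Let R v represent a(v, .) in the inner product of
   H^1_0.  By coercivity and Minty's trick the range of R is closed, and a vector z
   orthogonal to it satisfies a(z, z) = <R z, z> = 0, hence z = 0.  So R is onto.

   As the weak derivatives are arbitrary representatives, their linearity rests on
   du Bois-Reymond's lemma: a function orthogonal to all test functions has integral
   zero over every box in Om, hence vanishes a.e. *)
Require Import Defs.
From HB Require Import structures.
From mathcomp Require Import all_boot all_order all_algebra.
From mathcomp Require Import all_classical all_reals all_analysis measurable_realfun.
From mathcomp Require Import ring lra.

Set Implicit Arguments.
Unset Strict Implicit.
Unset Printing Implicit Defensive.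
Import Order.TTheory GRing.Theory Num.Theory.
Import numFieldNormedType.Exports.

Local Open Scope classical_set_scope.
Local Open Scope ring_scope.

(** * Semi-inner products *)

(** Functions that agree almost everywhere are not identified, so the $H^1$ product is only positive
    semidefinite. The Hilbert space theory is therefore developed for a semi-inner product on a
    subset [S] of a vector space, complete in the sequential sense, and its conclusions hold up to
    vectors of norm zero. Representers of functionals are then not unique, and the map $v \mapsto
    Rv$ is replaced by the set of all vectors that represent some $a(v,\cdot)$.

    Each $a(v,\cdot)$ is bounded with a constant depending on $v$. Minty's trick asks no more:
    monotonicity is used to move the form from the moving argument $v_n$ to a fixed one $z$ before
    the limit is taken.

    Orthogonal projection onto the range needs no separate theorem: it is Riesz representation
    applied a second time, with the range itself as the complete space. *)

(** The degenerate case [a = 0] matters: it covers vectors of norm zero in the Cauchy-Schwarz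
    inequality and directions of zero energy in Minty's argument. A negative [a] is excluded by a
    large [t]; a positive one is tested at the vertex [- b / a]. *)
Lemma discriminant_le (R : realFieldType) (a b c : R) :
  (forall t, 0 <= a * t ^+ 2 + 2 * b * t + c) -> b ^+ 2 <= a * c.
Proof.
move=> h; have [a0|a0] := eqVneq a 0.
  have [->|b0] := eqVneq b 0; first by rewrite a0; lra.
  have := h (- (c + 1) / (2 * b)).
  have -> : a * (- (c + 1) / (2 * b)) ^+ 2 + 2 * b * (- (c + 1) / (2 * b)) + c
      = -1 by rewrite a0; field.
  lra.
have a_gt0 : 0 < a.
  rewrite lt_neqAle eq_sym a0 /= leNgt; apply/negP => an.
  have c0 := h 0.
  (* With this [K] the quadratic at [K] is at most [K * (a - c - 1) + c], which is negative because
     [K >= 1] and [c >= 0]. *)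
  pose K := 1 + (2 * `|b| + c + 1) / (- a).
  have K1 : 1 <= K.
    rewrite lerDl; apply: divr_ge0; last lra.
    by have := normr_ge0 b; lra.
  have aK : a * (K - 1) = - (2 * `|b| + c + 1) by rewrite /K; field.
  have := h K; have bn := ler_norm b; nra.
have := h (- b / a).
have -> : a * (- b / a) ^+ 2 + 2 * b * (- b / a) + c = (a * c - b ^+ 2) / a.
  by field.
by rewrite pmulr_lge0 ?invr_gt0// subr_ge0.
Qed.

Section semi_hilbert.
Variables (R : realType) (V : lmodType R).
Implicit Types (S : set V) (B : V -> V -> R) (l : V -> R).

Definition subspace S := S 0 /\ forall a u v, S u -> S v -> S (a *: u + v).

Definition linear_on S l :=
  forall a u v, S u -> S v -> l (a *: u + v) = a * l u + l v.

(** Definiteness is left out because the vectors will be functions rather than classes. All laws are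
    restricted to [S], since integrals are additive only on integrable functions. *)
Definition semi_inner S B :=
  [/\ forall u v, S u -> S v -> B u v = B v u,
      forall w, S w -> linear_on S (B ^~ w)
    & forall u, S u -> 0 <= B u u].

Definition seq_complete S B := forall u : nat -> V, (forall n, S (u n)) ->
  (forall e, 0 < e -> exists N, forall m n, (N <= m)%N -> (N <= n)%N ->
     B (u m - u n) (u m - u n) < e) ->
  exists2 v, S v & forall e, 0 < e -> exists N, forall n, (N <= n)%N ->
     B (u n - v) (u n - v) < e.

Definition bounded_on S B l :=
  exists C, forall w, S w -> `|l w| <= C * Num.sqrt (B w w).

Section subspace.
Variable S : set V.
Hypothesis subS : subspace S.

Lemma subspaceD u v : S u -> S v -> S (u + v).
Proof. by move=> Su Sv; rewrite -[u]scale1r; apply subS. Qed.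

Lemma subspaceZ a u : S u -> S (a *: u).
Proof. by move=> Su; rewrite -[_ *: _]addr0; apply: subS.2 => //; exact: subS.1. Qed.

Lemma subspaceB u v : S u -> S v -> S (u - v).
Proof. by move=> Su Sv; rewrite -scaleN1r addrC; apply subS. Qed.

Variable l : V -> R.
Hypothesis lin : linear_on S l.

Lemma linear_onD u v : S u -> S v -> l (u + v) = l u + l v.
Proof. by move=> Su Sv; rewrite -[u]scale1r lin// !scale1r mul1r. Qed.

Lemma linear_on0 : l 0 = 0.
Proof.
have := linear_onD subS.1 subS.1; rewrite addr0 => h; lra.
Qed.

Lemma linear_onZ a u : S u -> l (a *: u) = a * l u.
Proof. by move=> Su; rewrite -[_ *: _]addr0 lin// ?linear_on0 ?addr0//; exact: subS.1. Qed.

Lemma linear_onB u v : S u -> S v -> l (u - v) = l u - l v.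
Proof. by move=> Su Sv; rewrite -scaleN1r addrC lin// mulN1r addrC. Qed.

End subspace.

Section inner.
Variables (S : set V) (B : V -> V -> R).
Hypotheses (subS : subspace S) (BS : semi_inner S B).

Let Bsym u v : S u -> S v -> B u v = B v u. Proof. by case: BS => h _ _; exact: h. Qed.
Let Bge0 u : S u -> 0 <= B u u. Proof. by case: BS => _ _; exact. Qed.
Let Bl w : S w -> linear_on S (B ^~ w). Proof. by case: BS => _ h _; exact: h. Qed.

Lemma semi_inner_linr w : S w -> linear_on S (B w).
Proof.
move=> Sw a u v Su Sv; have Suv : S (a *: u + v) by apply subS.
by rewrite Bsym// Bl// [B u w]Bsym// [B v w]Bsym.
Qed.

Lemma semi_inner_sqD t u v : S u -> S v ->
  B (t *: u + v) (t *: u + v) = B u u * t ^+ 2 + 2 * B u v * t + B v v.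
Proof.
move=> Su Sv; have Suv : S (t *: u + v) by apply subS.
rewrite Bl//= !semi_inner_linr// [B v u]Bsym//; ring.
Qed.

Lemma semi_inner_CS u v : S u -> S v -> B u v ^+ 2 <= B u u * B v v.
Proof.
move=> Su Sv; apply: discriminant_le => t; rewrite -semi_inner_sqD//.
by apply: Bge0; apply subS.
Qed.

Lemma semi_inner_CS_sqrt u v : S u -> S v ->
  `|B u v| <= Num.sqrt (B u u) * Num.sqrt (B v v).
Proof.
move=> Su Sv; rewrite -sqrtrM ?Bge0// -sqrtr_sqr ler_wsqrtr//.
exact: semi_inner_CS.
Qed.

Lemma semi_inner_triangle u v : S u -> S v ->
  Num.sqrt (B (u + v) (u + v)) <= Num.sqrt (B u u) + Num.sqrt (B v v).
Proof.
move=> Su Sv; rewrite -[leRHS]ger0_norm ?addr_ge0 ?sqrtr_ge0// -sqrtr_sqr.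
rewrite ler_wsqrtr// -[u in B (u + v)]scale1r -[u in B _ (u + v)]scale1r semi_inner_sqD//.
rewrite sqrrD !sqr_sqrtr ?Bge0//.
have := semi_inner_CS_sqrt Su Sv; have := ler_norm (B u v).
rewrite -mulr_natl; lra.
Qed.

Lemma semi_inner_sqN u : S u -> B (- u) (- u) = B u u.
Proof.
move=> Su; rewrite -scaleN1r -[_ *: _]addr0 semi_inner_sqD//; last exact: subS.1.
rewrite (linear_on0 subS (semi_inner_linr Su)).
rewrite (linear_on0 subS (semi_inner_linr subS.1)); ring.
Qed.

Lemma semi_inner_bounded u : S u -> bounded_on S B (B u).
Proof. by move=> Su; exists (Num.sqrt (B u u)) => w Sw; exact: semi_inner_CS_sqrt. Qed.

Lemma le_eps0 (x : R) K : (forall e, 0 < e -> `|x| <= K * e) -> x = 0.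
Proof.
move=> h; apply/eqP; rewrite -normr_eq0 eq_le normr_ge0 andbT.
apply/ler_addgt0Pr => e e0; rewrite add0r.
have K1 : 0 < `|K| + 1 by have := normr_ge0 K; lra.
apply: (le_trans (h (e / (`|K| + 1)) _)); first exact: divr_gt0.
rewrite mulrA ler_pdivrMr// [leRHS]mulrC ler_pM2r//.
by have := ler_norm K; lra.
Qed.

Hypothesis complB : seq_complete S B.

(** The representer is the limit of a minimising sequence of [J]. The Euler equation is obtained
    along the sequence, with an error that tends to 0, rather than at the limit, so continuity of
    [J] is never invoked. *)
Lemma riesz l : linear_on S l -> bounded_on S B l ->
  exists2 u, S u & forall w, S w -> l w = B u w.
Proof.
move=> lin [C lC].
pose J u := B u u - 2 * l u.
(* With [s] the norm of [u], [J u >= s ^+ 2 - 2 * C * s >= - C ^+ 2]. *)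
have JC u : S u -> - C ^+ 2 <= J u.
  move=> Su; have := lC u Su; have := sqr_sqrtr (Bge0 Su); rewrite /J.
  move: (Num.sqrt _) => s h0 h1; have h2 := ler_norm (l u).
  have := sqr_ge0 (C - s); nra.
pose E := [set J u | u in S].
have infE : has_inf E.
  split; first by exists (J 0); exists 0 => //; exact: subS.1.
  by exists (- C ^+ 2) => _ [u Su <-]; exact: JC.
pose d := inf E.
have Jd u : S u -> d <= J u by move=> Su; apply: ge_inf; [exact: infE.2|exists u].
have /choice[u u0P] : forall n, exists v, S v /\ J v < d + n.+1%:R^-1.
  move=> n.
  have n0 : 0 < n.+1%:R^-1 :> R by rewrite invr_gt0.
  by have [_ [v Sv <-] h] := inf_adherent n0 infE; exists v.
have Su n : S (u n) := (u0P n).1.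
have [||v Sv uv] := complB (u := u) => //.
  move=> e e0; have e4 : 0 < e / 4 by exact: divr_gt0.
  have [N] := ltr_add_invr e4.
  rewrite add0r => Ne; exists N => m n Nm Nn.
  have inve k : (N <= k)%N -> k.+1%:R^-1 < e / 4 :> R.
    by move=> Nk; apply: le_lt_trans Ne; rewrite lef_pV2 ?posrE// ler_nat.
  have Jm := (u0P m).2; have Jn := (u0P n).2.
  (* Parallelogram identity: [B (u m - u n) (u m - u n)] is [2 * J (u m) + 2 * J (u n)] minus four
     times [J] at the midpoint. It is less than [e] once both values of [J] are within [e / 4] of
     the infimum. *)
  have Smid : S (2^-1 *: (u m + u n)) by apply: subspaceZ => //; exact: subspaceD.
  have := Jd _ Smid; rewrite /J.
  rewrite (linear_onZ subS lin) ?(linear_onD lin)//; last exact: subspaceD.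
  have -> : B (2^-1 *: (u m + u n)) (2^-1 *: (u m + u n)) =
      (B (u m) (u m) + 2 * B (u m) (u n) + B (u n) (u n)) / 4.
    have Smn : S (u m + u n) by exact: subspaceD.
    rewrite -[2^-1 *: _]addr0 semi_inner_sqD//; last exact: subS.1.
    rewrite (linear_on0 subS (semi_inner_linr Smn)).
    rewrite (linear_on0 subS (semi_inner_linr subS.1)).
    rewrite -[X in B (X + _)]scale1r -[X in B _ (X + _)]scale1r semi_inner_sqD//.
    by field.
  have -> : B (u m - u n) (u m - u n) =
      B (u m) (u m) - 2 * B (u m) (u n) + B (u n) (u n).
    rewrite [u m - _]addrC -scaleN1r semi_inner_sqD// [B (u n) (u m)]Bsym//; ring.
  have := inve m Nm; have := inve n Nn; move: Jm Jn; rewrite /J; move: (n.+1%:R^-1) (m.+1%:R^-1) => a b; lra.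
exists v => // w Sw; apply/eqP; rewrite -subr_eq0; apply/eqP.
have Bw := Bge0 Sw.
apply: (@le_eps0 _ (2 * Num.sqrt (B w w))) => e e0.
have e2 : 0 < e ^+ 2 by exact: exprn_gt0.
have [N1 N1P] := uv _ e2; have [N2] := ltr_add_invr e2.
rewrite add0r => N2e; pose n := maxn N1 N2.
have un := N1P n (leq_maxl _ _).
have ne : n.+1%:R^-1 <= e ^+ 2 :> R.
  by apply: le_trans (ltW N2e); rewrite lef_pV2 ?posrE// ler_nat ltnS leq_maxr.
(* Comparing [J (t *: w + u n)] with the infimum gives a quadratic in [t], nonnegative for all [t],
   with leading coefficient [B w w] and constant term [n.+1%:R^-1]. Its discriminant bounds the
   defect in the Euler equation. *)
have h1 : `|l w - B (u n) w| <= Num.sqrt (B w w) * e.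
  rewrite -[X in _ * X](ger0_norm (ltW e0)) -[`|e|]sqrtr_sqr -sqrtrM// -sqrtr_sqr.
  rewrite ler_wsqrtr//.
  apply: (@le_trans _ _ (B w w * n.+1%:R^-1)); last exact: ler_wpM2l.
  rewrite -[leLHS]sqrrN; apply: discriminant_le => t.
  have := Jd (t *: w + u n) (subS.2 _ _ _ Sw (Su n)); have := (u0P n).2.
  rewrite /J semi_inner_sqD// lin// [B w (u n)]Bsym//.
  move: (n.+1%:R^-1) => a; lra.
have h2 : `|B (u n - v) w| <= e * Num.sqrt (B w w).
  apply: le_trans (semi_inner_CS_sqrt (subspaceB subS (Su n) Sv) Sw) _.
  apply: ler_wpM2r; first exact: sqrtr_ge0.
  rewrite -[leRHS](ger0_norm (ltW e0)) -sqrtr_sqr ler_wsqrtr//; exact: ltW.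
have -> : l w - B v w = (l w - B (u n) w) + B (u n - v) w.
  rewrite (linear_onB (l := B ^~ w) (Bl Sw))//; ring.
apply: le_trans (ler_normD _ _) _; lra.
Qed.

End inner.

(** * Lax-Milgram for coercive forms bounded in the second argument *)

Section lax_milgram.
Variables (S : set V) (B : V -> V -> R).
Hypotheses (subS : subspace S) (BS : semi_inner S B) (complB : seq_complete S B).

Let Bsym u v : S u -> S v -> B u v = B v u. Proof. by case: BS => h _ _; exact: h. Qed.
Let Bge0 u : S u -> 0 <= B u u. Proof. by case: BS => _ _; exact. Qed.
Let Bl w : S w -> linear_on S (B ^~ w). Proof. by case: BS => _ h _; exact: h. Qed.

Variables (A : V -> V -> R) (c : R).
Hypotheses (c_gt0 : 0 < c)
  (A_linl : forall w, S w -> linear_on S (A ^~ w))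
  (A_linr : forall v, S v -> linear_on S (A v))
  (A_bnd : forall v, S v -> bounded_on S B (A v))
  (A_coercive : forall v, S v -> c * B v v <= A v v).

Let range := [set u | S u /\ exists2 v, S v & forall w, S w -> A v w = B u w].

Let range_sub : subspace range.
Proof.
split.
  split; first exact: subS.1.
  exists 0; first exact: subS.1.
  move=> w Sw; rewrite (linear_on0 subS (A_linl Sw)).
  by rewrite (linear_on0 subS (Bl Sw)).
move=> a u1 u2 [Su1 [v1 Sv1 e1]] [Su2 [v2 Sv2 e2]]; split; first by apply subS.
exists (a *: v1 + v2); first by apply subS.
by move=> w Sw; rewrite A_linl// Bl// e1// e2.
Qed.

(* Coercivity makes the preimages of a Cauchy sequence Cauchy; since A need not
   be continuous, the limits are matched by Minty's trick. *)
Let range_complete : seq_complete range B.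
Proof.
move=> u Ru uC.
have Su n : S (u n) := (Ru n).1.
have /choice[v v0P] : forall n, exists v, S v /\
    forall w, S w -> A v w = B (u n) w.
  move=> n.
  by have [_ [x Sx h]] := Ru n; exists x.
have Sv n : S (v n) := (v0P n).1.
have Av n w : S w -> A (v n) w = B (u n) w := (v0P n).2 w.
(* Coercivity bounds [c] times the squared norm of [v m - v n] by [B (u m - u n) (v m - v n)].
   Cauchy-Schwarz then allows one factor to be cancelled, unless that norm is 0. *)
have vu m n : c ^+ 2 * B (v m - v n) (v m - v n) <= B (u m - u n) (u m - u n).
  have Sd : S (v m - v n) by exact: subspaceB.
  have Sdu : S (u m - u n) by exact: subspaceB.
  have := A_coercive Sd.
  rewrite (linear_onB (l := A ^~ (v m - v n)) (A_linl Sd))//= !Av//.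
  rewrite -(linear_onB (l := B ^~ (v m - v n)) (Bl Sd))//=.
  have := semi_inner_CS subS BS Sdu Sd; have := Bge0 Sd; have := Bge0 Sdu.
  move: (B (v m - v n) _) (B (u m - u n) (u m - u n)) (B (u m - u n) _) => x y z.
  move=> y0 x0 zxy cxz.
  have [x00|xn0] := eqVneq x 0; first by rewrite x00 mulr0.
  have xgt : 0 < x by rewrite lt_neqAle eq_sym xn0.
  rewrite -(ler_pM2r xgt); apply: le_trans zxy.
  rewrite -mulrA -expr2 -exprMn; apply: lerXn2r => //; rewrite nnegrE.
    by rewrite mulr_ge0// ltW.
  by apply: le_trans cxz; rewrite mulr_ge0// ltW.
have [//|x Sx ux] := complB Su.
have [|y Sy vy] := complB Sv.
  move=> e e0; have c2e : 0 < c ^+ 2 * e by rewrite mulr_gt0// exprn_gt0.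
  have [N h] := uC _ c2e; exists N => m n Nm Nn.
  have := le_lt_trans (vu m n) (h m n Nm Nn).
  by rewrite ltr_pM2l// exprn_gt0.
exists x => //; split=> //; exists y => // w Sw.
(* This is the limit of [0 <= B (u n) (v n - z) - A z (v n - z)], which is monotonicity of [A]
   between [v n] and [z]. The form now has the fixed first argument [z], where it is bounded. *)
have minty z : S z -> 0 <= B x (y - z) - A z (y - z).
  move=> Sz; have [C AC] := A_bnd Sz.
  have Syz : S (y - z) by exact: subspaceB.
  rewrite leNgt; apply/negP => neg.
  (* [K * e] is the sum of the three error terms [b1], [b2], [b3] below. The summand 1 bounds the
     norm of [v n - y], which is why [e <= 1] is imposed. *)
  pose K := Num.sqrt (B (y - z) (y - z)) + Num.sqrt (B x x) + 1 + `|C|.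
  have K0 : 0 < K.
    by rewrite /K; have := normr_ge0 C; have := sqrtr_ge0 (B x x);
       have := sqrtr_ge0 (B (y - z) (y - z)); lra.
  pose g := - (B x (y - z) - A z (y - z)); have g0 : 0 < g by rewrite /g; lra.
  pose e := Num.min 1 (g / (2 * K)).
  have e0 : 0 < e by rewrite lt_min ltr01 divr_gt0// mulr_gt0.
  have e1 : e <= 1 by rewrite ge_min lexx.
  have eK : K * e <= g / 2.
    apply: (@le_trans _ _ (K * (g / (2 * K)))).
      by rewrite ler_pM2l// ge_min lexx orbT.
    rewrite le_eqVlt; apply/orP; left; apply/eqP; field.
    by rewrite gt_eqF.
  have e2 : 0 < e ^+ 2 by exact: exprn_gt0.
  have [N1 h1] := ux _ e2; have [N2 h2] := vy _ e2.
  pose n := maxn N1 N2.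
  have se a : a < e ^+ 2 -> Num.sqrt a <= e.
    move=> ae; rewrite -[leRHS](ger0_norm (ltW e0)) -sqrtr_sqr ler_wsqrtr//; exact: ltW.
  have {}h1 := se _ (h1 n (leq_maxl _ _)); have {}h2 := se _ (h2 n (leq_maxr _ _)).
  have Sux : S (u n - x) by exact: subspaceB.
  have Svy : S (v n - y) by exact: subspaceB.
  have Svz : S (v n - z) by exact: subspaceB.
  have pos : 0 <= B (u n) (v n - z) - A z (v n - z).
    rewrite -Av// -(linear_onB (l := A ^~ (v n - z)) (A_linl Svz))//.
    by apply: le_trans (A_coercive Svz); rewrite mulr_ge0 ?Bge0// ltW.
  have dec : v n - z = (v n - y) + (y - z) by rewrite addrA subrK.
  have decu : u n = (u n - x) + x by rewrite subrK.
  have E1 : B (u n) (v n - z) = B (u n - x) (v n - z) + B x (v n - y) + B x (y - z).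
    rewrite {1}decu (linear_onD (l := B ^~ (v n - z)) (Bl Svz))//.
    rewrite {2}dec (linear_onD (l := B x) (semi_inner_linr subS BS Sx))// addrA //.
  have E2 : A z (v n - z) = A z (v n - y) + A z (y - z).
    by rewrite {1}dec (linear_onD (l := A z) (A_linr Sz)).
  have b1 : B (u n - x) (v n - z) <= e * (1 + Num.sqrt (B (y - z) (y - z))).
    apply: le_trans (ler_norm _) _.
    apply: le_trans (semi_inner_CS_sqrt subS BS Sux Svz) _.
    apply: ler_pM => //; rewrite ?sqrtr_ge0//.
    rewrite dec; apply: le_trans (semi_inner_triangle subS BS Svy Syz) _; lra.
  have b2 : B x (v n - y) <= Num.sqrt (B x x) * e.
    apply: le_trans (ler_norm _) _.
    apply: le_trans (semi_inner_CS_sqrt subS BS Sx Svy) _.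
    by apply: ler_wpM2l => //; exact: sqrtr_ge0.
  have b3 : - A z (v n - y) <= `|C| * e.
    apply: (@le_trans _ _ `|A z (v n - y)|).
      by have := ler_norm (- A z (v n - y)); rewrite normrN.
    apply: le_trans (AC _ Svy) _.
    apply: (@le_trans _ _ (`|C| * Num.sqrt (B (v n - y) (v n - y)))).
      by apply: ler_wpM2r (ler_norm _); exact: sqrtr_ge0.
    by apply: ler_wpM2l => //.
  move: pos eK; rewrite E1 E2 /K /g; nra.
(* Minty's inequality at [z = y - t *: w]. A quadratic without constant term that is nonnegative for
   every [t] has no linear term. *)
have quad t : 0 <= A w w * t ^+ 2 + 2 * ((B x w - A y w) / 2) * t + 0.
  have Stw : S (t *: w) by exact: subspaceZ.
  have := minty _ (subspaceB subS Sy Stw).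
  have -> : y - (y - t *: w) = t *: w by rewrite opprB addrC subrK.
  rewrite (linear_onB (l := A ^~ (t *: w)) (A_linl Stw))//.
  rewrite (linear_onZ subS (semi_inner_linr subS BS Sx))// !(linear_onZ subS (A_linr _))//.
  rewrite (linear_onZ subS (A_linl Sw))//.
  by move=> h; apply: le_trans h _; rewrite le_eqVlt; apply/orP; left; apply/eqP; field.
have := discriminant_le quad; rewrite mulr0 => h.
have : (B x w - A y w) / 2 = 0.
  by apply/eqP; rewrite -sqrf_eq0 eq_le h sqr_ge0.
lra.
Qed.

(** The representer [f] of [l] is projected onto the range by a second use of [riesz]. The residual
    [f - u] is orthogonal to the range, in particular to the representer [z'] of [A (f - u)], so
    coercivity gives it norm zero. It need not be the zero vector, and Cauchy-Schwarz removes it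
    from the pairing with [w]. *)
Lemma lax_milgram l : linear_on S l -> bounded_on S B l ->
  exists2 v, S v & forall w, S w -> A v w = l w.
Proof.
move=> lin lbd; have [f Sf lf] := riesz subS BS complB lin lbd.
have rS u : range u -> S u by case.
have Br : semi_inner range B.
  split=> [u v /rS ? /rS ?|w /rS Sw a u v /rS ? /rS ?|u /rS ?]; [exact: Bsym|exact: Bl|exact: Bge0].
suff [u [Su [v Sv Av]] fu] : exists2 u, range u & forall w, range w -> B f w = B u w.
  exists v => // w Sw.
  have Sz : S (f - u) by exact: subspaceB.
  have [C AC] := A_bnd Sz.
  have [z' Sz' Az'] := riesz subS BS complB (A_linr Sz) (A_bnd Sz).
  have Rz' : range z' by split=> //; exists (f - u).
  have : A (f - u) (f - u) = 0.
    rewrite Az'// Bsym// (linear_onB (l := B ^~ z') (Bl Sz'))// fu//; ring.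
  have := A_coercive Sz => + Az0; rewrite Az0 => cB.
  have Bz0 : B (f - u) (f - u) = 0.
    by apply/eqP; rewrite eq_le Bge0// andbT; rewrite -(ler_pM2l c_gt0) mulr0.
  have : B (f - u) w = 0.
    have := semi_inner_CS subS BS Sz Sw; rewrite Bz0 mul0r => h.
    by apply/eqP; rewrite -sqrf_eq0 eq_le h sqr_ge0.
  rewrite (linear_onB (l := B ^~ w) (Bl Sw))// Av// lf//; lra.
apply: (riesz range_sub Br range_complete).
  by move=> a u v /rS Su /rS Sv; apply: (semi_inner_linr subS BS Sf).
have [C fC] := semi_inner_bounded subS BS Sf.
by exists C => w /rS; exact: fC.
Qed.

End lax_milgram.
End semi_hilbert.

(** * Square integrable matrix fields *)

Section frobenius.
Variable R : realType.
Implicit Types (m n : nat).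

Lemma frobE m n (X Y : 'M[R]_(m, n)) : frob X Y = \sum_i \sum_j X i j * Y i j.
Proof.
by rewrite /frob /mxtrace; apply: eq_bigr => i _; rewrite mxE; apply: eq_bigr => j _; rewrite mxE.
Qed.

Lemma frobC m n (X Y : 'M[R]_(m, n)) : frob X Y = frob Y X.
Proof. by rewrite !frobE; apply: eq_bigr => i _; apply: eq_bigr => j _; rewrite mulrC. Qed.

Lemma frobDl m n a (X Y Z : 'M[R]_(m, n)) :
  frob (a *: X + Y) Z = a * frob X Z + frob Y Z.
Proof. by rewrite /frob mulmxDl mxtraceD -scalemxAl mxtraceZ. Qed.

Lemma frob_ge0 m n (X : 'M[R]_(m, n)) : 0 <= frob X X.
Proof. by rewrite frobE; apply: sumr_ge0 => i _; apply: sumr_ge0 => j _; rewrite -expr2 sqr_ge0. Qed.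

Lemma frob_entry_le m n (X : 'M[R]_(m, n)) i j : X i j ^+ 2 <= frob X X.
Proof.
rewrite frobE (bigD1 i)//= (bigD1 j)//= -addrA expr2 lerDl addr_ge0//.
  by apply: sumr_ge0 => k _; rewrite -expr2 sqr_ge0.
by apply: sumr_ge0 => k _; apply: sumr_ge0 => l _; rewrite -expr2 sqr_ge0.
Qed.

Lemma fnorm_sqr m n (X : 'M[R]_(m, n)) : fnorm X ^+ 2 = frob X X.
Proof. by rewrite /fnorm sqr_sqrtr// frob_ge0. Qed.

Lemma frob_eq0 m n (X : 'M[R]_(m, n)) : frob X X = 0 -> X = 0.
Proof.
move=> X0; apply/matrixP => i j; rewrite mxE; apply/eqP.
by rewrite -sqrf_eq0 eq_le sqr_ge0 andbT -X0 frob_entry_le.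
Qed.

Lemma sympartDl a (X Y : 'M[R]_3) :
  sympart (a *: X + Y) = a *: sympart X + sympart Y.
Proof.
by apply/matrixP => i j; rewrite !mxE; ring.
Qed.

Lemma sympart_sym (X : 'M[R]_3) : sympart X \is symmetricmx.
Proof.
by apply/eqP/matrixP => i j; rewrite !mxE expr0 mul1r addrC.
Qed.

Lemma frob_tr m n (X Y : 'M[R]_(m, n)) : frob X^T Y^T = frob X Y.
Proof. by rewrite /frob trmxK mxtrace_mulC -mxtrace_tr trmx_mul trmxK -/(frob _ _). Qed.

(** A symmetric matrix pairs equally with [Y] and [Y^T]. This turns the product of the stress rate
    with the full gradient into its product with the strain rate, the only quantity that positive
    definiteness controls. *)
Lemma frob_sympart (X Y : 'M[R]_3) : X \is symmetricmx ->
  frob X (sympart Y) = frob X Y.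
Proof.
move=> /eqP /=; rewrite expr0 scale1r => XT.
have -> : frob X (sympart Y) = 2^-1 * (frob X Y + frob X Y^T).
  rewrite !frobE -big_split mulr_sumr; apply: eq_bigr => i _ /=.
  by rewrite -big_split mulr_sumr; apply: eq_bigr => j _ /=; rewrite !mxE; ring.
have -> : frob X Y^T = frob X Y.
  rewrite -[RHS]frob_tr !frobE; apply: eq_bigr => i _; apply: eq_bigr => j _.
  by rewrite {1}XT !mxE.
by field.
Qed.

End frobenius.

Section square_integrable.
Context d (T : measurableType d) (R : realType).
Variables (mu : {measure set T -> \bar R}) (D : set T).
Hypothesis mD : measurable D.
Implicit Types f g : T -> R.

Lemma L2P f : L2 mu D f <->
  measurable_fun D f /\ mu.-integrable D (EFin \o (fun x => f x ^+ 2)).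
Proof.
split=> [Lf|[mf If]].
  split.
    have /set_mem mfD := sub_Lfun_mfun Lf.
    by apply/(measurable_restrictT f mD).
  apply/(integrable_mkcond _ mD); have := Lfun2_integrable_sqr Lf.
  apply: eq_integrable => // x _ /=; rewrite !patchE; case: ifP => //.
  by rewrite expr0n.
apply/andP; split; first by rewrite inE; apply/(measurable_restrictT f mD).
rewrite inE /= /finite_norm unlock /=.
apply: poweR_lty.
have /(integrable_mkcond _ mD)/integrableP[_] := If.
apply: le_lt_trans; rewrite le_eqVlt; apply/orP; left; apply/eqP.
apply: eq_integral => x _ /=; rewrite !patchE; case: ifP => _ /=.
  by rewrite powR_mulrn// real_normK ?num_real// ger0_norm ?sqr_ge0.
by rewrite normr0 powR0.
Qed.

Lemma L2_measurable f : L2 mu D f -> measurable_fun D f.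
Proof. by move/L2P => []. Qed.

Lemma L2_integrable_mul f g : L2 mu D f -> L2 mu D g ->
  mu.-integrable D (EFin \o (fun x => f x * g x)).
Proof.
move=> Lf Lg; apply/(integrable_mkcond _ mD).
have /Lfun1_integrable := Lfun2_mul_Lfun1 Lf Lg.
apply: eq_integrable => // x _ /=; rewrite !patchE; case: ifP => //.
by rewrite mul0r.
Qed.

Lemma L2_lin a f g : L2 mu D f -> L2 mu D g -> L2 mu D (fun x => a * f x + g x).
Proof.
rewrite /L2 => Lf Lg.
have -> : (fun x => a * f x + g x) \_ D = a *: (f \_ D) + g \_ D.
  apply/funext => x; rewrite /= !fctE !patchE; case: ifP => //.
  by rewrite scaler0 addr0.
have two_ge1 : (1 <= 2%:E :> \bar R)%E by rewrite lee_fin ler1n.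
by case: (Lfun_submod_closed mu two_ge1) => _; exact.
Qed.

Lemma L2_cst0 : L2 mu D (fun=> 0).
Proof.
apply/L2P; split=> //; have := integrable0 mu D; apply: eq_integrable => // x _ /=.
by rewrite expr0n.
Qed.

End square_integrable.

Section L2_matrix.
Context d (T : measurableType d) (R : realType).
Variables (mu : {measure set T -> \bar R}) (D : set T).
Hypothesis mD : measurable D.
Variables m n : nat.
Implicit Types F G : T -> 'M[R]_(m, n).

Definition L2dot F G := \int[mu]_(x in D) frob (F x) (G x).

Lemma L2mx_integrable_frob F G : L2mx mu D F -> L2mx mu D G ->
  mu.-integrable D (EFin \o (fun x => frob (F x) (G x))).
Proof.
move=> LF LG.
have -> : EFin \o (fun x => frob (F x) (G x)) =
    fun x => (\sum_i (\sum_j (F x i j * G x i j)%:E))%E.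
  by apply/funext => x /=; rewrite frobE -sumEFin; apply: eq_bigr => i _; rewrite sumEFin.
apply: integrable_sum => // i _; apply: integrable_sum => // j _.
exact: (L2_integrable_mul mD (LF i j) (LG i j)).
Qed.

Lemma L2dot_sum F G : L2mx mu D F -> L2mx mu D G ->
  L2dot F G = \sum_i \sum_j \int[mu]_(x in D) (F x i j * G x i j).
Proof.
move=> LF LG; have I i j := L2_integrable_mul mD (LF i j) (LG i j).
apply: EFin_inj; rewrite /L2dot /Rintegral fineK; last first.
  exact: integrable_fin_num (L2mx_integrable_frob LF LG).
under eq_integral => x _ do rewrite frobE -sumEFin.
rewrite integral_sum//; last first.
  move=> i; have : mu.-integrable D (fun x => (\sum_j (F x i j * G x i j)%:E)%E).
    by apply: integrable_sum => // j _; exact: I.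
  by apply: eq_integrable => // x _; rewrite sumEFin.
rewrite -sumEFin; apply: eq_bigr => i _.
under eq_integral => x _ do rewrite -sumEFin.
rewrite integral_sum//; last by move=> j; exact: I.
rewrite -sumEFin; apply: eq_bigr => j _; rewrite fineK//.
exact: integrable_fin_num (I i j).
Qed.

Lemma subspace_L2mx : subspace (@L2mx _ _ _ mu D m n).
Proof.
split=> [i j|a F G LF LG i j].
  by under [X in L2 _ _ X]eq_fun do rewrite mxE; exact: L2_cst0.
under [X in L2 _ _ X]eq_fun do rewrite !mxE.
by apply: L2_lin; [exact: LF|exact: LG].
Qed.

Lemma semi_inner_L2dot : semi_inner (@L2mx _ _ _ mu D m n) L2dot.
Proof.
split=> [F G _ _|G LG a F1 F2 L1 L2|F LF].
- by apply: eq_Rintegral => x _; exact: frobC.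
- rewrite /L2dot -RintegralZl//; last exact: L2mx_integrable_frob.
  rewrite -RintegralD//; [|exact: (integrableZl mD _ (L2mx_integrable_frob L1 LG))|exact: L2mx_integrable_frob].
  by apply: eq_Rintegral => x _; rewrite -frobDl.
- by apply: Rintegral_ge0 => x _; exact: frob_ge0.
Qed.

Lemma L2dot_eq0 F : L2mx mu D F -> L2dot F F = 0 -> F = (fun=> 0) %[ae mu in D].
Proof.
move=> LF F0; have IF := L2mx_integrable_frob LF LF.
have : (\int[mu]_(x in D) `|(frob (F x) (F x))%:E| = 0)%E.
  under eq_integral => x _ do rewrite gee0_abs ?lee_fin ?frob_ge0//.
  by rewrite -[LHS]fineK ?(integrable_fin_num _ IF)//; congr EFin.
move/integrableP: (IF) => [mF _].
move/(ae_eq_integral_abs mu mD mF); apply: filterS => x h Dx.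
by apply: frob_eq0; case: (h Dx).
Qed.

End L2_matrix.

(** * Completeness of L^2 *)

Section L2_complete.
Context d (T : measurableType d) (R : realType).
Variables (mu : {measure set T -> \bar R}) (D : set T).
Hypothesis mD : measurable D.

Lemma summable_diff_cvg (u : nat -> R) (w : nat -> R) (s : R) :
  (forall k, 0 < w k) ->
  (forall n, \sum_(0 <= k < n) ((u k.+1 - u k) ^+ 2 / w k + w k) <= s) ->
  cvgn u.
Proof.
move=> w0 us.
have : cvgn [normed series (telescope u)].
  apply: nondecreasing_is_cvgn.
    by apply: nondecreasing_series => n _ _ /=; exact: normr_ge0.
  exists s => _ [n _ <-]; apply: le_trans (us n); rewrite /series /=.
  apply: ler_sum => k _; rewrite /telescope /=.
  have := w0 k; move: (w k) (u k.+1 - u k) => a x a0.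
  rewrite -[x ^+ 2](real_normK (num_real x)); move: `|x| (normr_ge0 x) => {}x x0.
  rewrite -(ler_pM2r a0) mulrDl mulfVK ?gt_eqF//.
  have := sqr_ge0 (x - a); have := mulr_ge0 x0 (ltW a0); nra.
move/normed_cvg; rewrite telescopeK => ul.
rewrite (_ : u = [sequence u n - u 0%N]_n + cst (u 0%N)).
  by apply: is_cvgD => //; exact: is_cvg_cst.
by apply/funext => n; rewrite !fctE subrK.
Qed.

Let sqint f := (\int[mu]_(x in D) (f x ^+ 2)%:E)%E.

(* Choose a subsequence whose increments d_k satisfy int d_k^2 <= w_k^2 with w
   summable: since |d| <= d^2 / w + w it converges a.e., and Fatou's lemma carries
   the Cauchy estimate to its limit. *)
Lemma L2_complete (u : nat -> T -> R) : (forall n, L2 mu D (u n)) ->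
  (forall e, 0 < e -> exists N, forall m n, (N <= m)%N -> (N <= n)%N ->
     \int[mu]_(x in D) (u m x - u n x) ^+ 2 < e) ->
  exists2 v, L2 mu D v & forall e, 0 < e -> exists N, forall n, (N <= n)%N ->
     \int[mu]_(x in D) (u n x - v x) ^+ 2 < e.
Proof.
move=> Lu uC.
have mu_ n : measurable_fun D (u n) by exact: L2_measurable.
have Ld m n : L2 mu D (fun x => u m x - u n x).
  have -> : (fun x => u m x - u n x) = (fun x => -1 * u n x + u m x).
    by apply/funext => x; rewrite mulN1r addrC.
  exact: L2_lin.
have sqE f : L2 mu D f -> sqint f = (\int[mu]_(x in D) f x ^+ 2)%:E.
  move=> /(L2P mu mD _)[_ If]; rewrite /sqint /Rintegral fineK//.
  exact: integrable_fin_num If.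
(* The terms have the shape required by [epsilon_trick0], so they sum to at most 1. *)
pose w k : R := 1 / (2 ^ k.+1)%:R.
have w0 k : 0 < w k by rewrite divr_gt0// ltr0n expn_gt0.
have /choice[N NP] : forall k, exists N, forall m n, (N <= m)%N -> (N <= n)%N ->
     \int[mu]_(x in D) (u m x - u n x) ^+ 2 < w k ^+ 2.
  by move=> k; apply: uC; rewrite exprn_gt0.
(* Summing the [(N j).+1] makes the indices nondecreasing in [k], at least [N k], and at least
   [k]. *)
pose i k := (\sum_(j < k.+1) (N j).+1)%N.
have iS k : (i k <= i k.+1)%N by rewrite /i [leqRHS]big_ord_recr leq_addr.
have iN k : (N k <= i k)%N.
  by rewrite /i big_ord_recr /=; apply: leq_trans (leqnSn _) _; exact: leq_addl.
have ik k : (k <= i k)%N.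
  elim: k => // k IH; rewrite /i big_ord_recr /= addnS ltnS.
  by apply: leq_trans IH _; exact: leq_addr.
pose h k x := ((u (i k.+1) x - u (i k) x) ^+ 2 / w k)%:E.
have h0 k x : (0 <= h k x)%E.
  by rewrite lee_fin divr_ge0 ?sqr_ge0// ltW.
have mh k : measurable_fun D (h k).
  apply/measurable_EFinP; apply: measurable_funM => //.
  by apply: measurable_funX; exact: measurable_funB.
have inth k : (\int[mu]_(x in D) h k x <= (w k)%:E)%E.
  rewrite /h; under eq_integral => x _ do rewrite mulrC EFinM.
  rewrite ge0_integralZl//; last 3 first.
  - by apply/measurable_EFinP; apply: measurable_funX; exact: measurable_funB.
  - by move=> x _; rewrite lee_fin sqr_ge0.
  - by rewrite lee_fin invr_ge0 ltW.
  rewrite -/(sqint (fun x => u (i k.+1) x - u (i k) x)) sqE// -EFinM lee_fin.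
  rewrite mulrC ler_pdivrMr// -expr2; apply/ltW/NP => //.
  by apply: leq_trans (iN k) _; exact: iS.
pose s x := (\sum_(0 <= k <oo) h k x)%E.
have ms : measurable_fun D s.
  by apply: (ge0_emeasurable_sum (P := xpredT)).
have ints : (\int[mu]_(x in D) s x < +oo)%E.
  rewrite integral_nneseries//; apply: (@le_lt_trans _ _ 1%:E); last exact: ltry.
  apply: le_trans (epsilon_trick0 xpredT ler01).
  by apply: lee_nneseries => [k _ _|k _]; [exact: integral_ge0|exact: inth].
have s0 x : (0 <= s x)%E by apply: nneseries_ge0.
have Is : mu.-integrable D s.
  by apply/integrableP; split=> //; under eq_integral => x _ do rewrite gee0_abs//.
pose C := D `&` [set x | s x \is a fin_num].
have mC : measurable C by exact: emeasurable_fin_num.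
have aeC : {ae mu, forall x, D x -> C x}.
  by have := integrable_ae mD Is; apply: filterS => x hx Dx; split=> //; exact: hx.
(* Set to zero off [C], the subsequence converges at every point, so its pointwise limit is
   measurable; [C] exhausts [D] up to a null set. *)
pose U k := (u (i k)) \_ C.
have mU k : measurable_fun D (U k).
  apply/(measurable_restrict _ mC mD); rewrite setIidr//; last by move=> ? [].
  by apply: measurable_funS (mu_ (i k)) => //; move=> ? [].
have cU x : cvgn (U ^~ x).
  rewrite /U; case: (pselect (C x)) => Cx; last first.
    rewrite (_ : (fun k => _) = cst 0); first exact: is_cvg_cst.
    by apply/funext => k; rewrite patchE memNset.
  have -> : (fun k => (u (i k) \_ C) x) = (fun k => u (i k) x).
    by apply/funext => k; rewrite patchE mem_set.
  apply: (@summable_diff_cvg _ w (fine (s x) + 1)) => // n.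
  rewrite -lee_fin EFinD fineK; last exact: Cx.2.
  rewrite big_split /= EFinD; apply: leeD.
    by rewrite -sumEFin; apply: (nneseries_lim_ge (u_ := h ^~ x)) => k _ _; exact: h0.
  apply: le_trans (epsilon_trick0 xpredT ler01).
  rewrite -sumEFin; apply: nneseries_lim_ge => k _ _.
  by rewrite lee_fin divr_ge0// ler0n.
pose v x := limn (U ^~ x).
have mv : measurable_fun D v.
  by apply: (measurable_fun_cvg mU) => x _; exact: cU.
have key e : 0 < e -> exists N, forall n, (N <= n)%N ->
    (sqint (fun x => (u n x - v x)%R) <= e%:E)%E.
  move=> e0; have [N0 N0P] := uC _ e0; exists N0 => n nN0.
  (* The shift by [N0] keeps every index [i (k + N0)] at least [N0], so each integral is below [e]
     before Fatou's lemma is applied. *)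
  pose f k x := ((u n x - U (k + N0)%N x) ^+ 2)%:E.
  have fl x : limn_einf (f ^~ x) = ((u n x - v x) ^+ 2)%:E.
    have fv : f ^~ x @ \oo --> ((u n x - v x) ^+ 2)%:E.
      apply/fine_cvgP; split; first by apply: nearW.
      have -> : fine \o f^~ x = fun k => (u n x - U (k + N0)%N x) * (u n x - U (k + N0)%N x).
        by apply/funext => k /=; rewrite expr2.
      rewrite expr2.
      have UN : (fun k => U (k + N0)%N x) @ \oo --> v x.
        by rewrite (cvg_shiftn N0 (U ^~ x)); exact: cU.
      by apply: cvgM; apply: cvgB => //; exact: cvg_cst.
    rewrite is_cvg_limn_einfE; first exact/cvg_lim.
    by apply/cvg_ex; eexists; exact: fv.
  have fe k : (\int[mu]_(x in D) f k x <= e%:E)%E.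
    rewrite (_ : integral _ _ _ = sqint (fun x => u n x - u (i (k + N0)%N) x)).
      rewrite sqE// lee_fin; apply/ltW/N0P => //.
      by apply: leq_trans (ik _); exact: leq_addl.
    apply: ge0_ae_eq_integral => //.
    - by apply/measurable_EFinP; apply: measurable_funX; exact: measurable_funB.
    - by apply/measurable_EFinP; apply: measurable_funX; exact: measurable_funB.
    - by move=> x _; rewrite lee_fin sqr_ge0.
    - by move=> x _; rewrite lee_fin sqr_ge0.
    - by apply: filterS aeC => x hx Dx; rewrite /f /U patchE mem_set//; exact: hx.
  rewrite /sqint; under eq_integral => x _ do rewrite -fl.
  apply: (le_trans (fatou mu mD _ _)).
  - by move=> k; apply/measurable_EFinP; apply: measurable_funX; exact: measurable_funB.
  - by move=> k x _; rewrite lee_fin sqr_ge0.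
  rewrite limn_einf_lim; apply: lime_le; first exact: is_cvg_einfs.
  near=> k; apply: le_trans (fe k); apply: ereal_inf_lbound.
  by exists k => //=.
have Ldv (e : R) : 0 < e -> exists N, forall n, (N <= n)%N ->
    L2 mu D (fun x => u n x - v x).
  move=> e0; have [N0 N0P] := key e e0; exists N0 => n /N0P h1; apply/(L2P mu mD); split.
    exact: measurable_funB.
  apply/integrableP; split.
    by apply/measurable_EFinP; apply: measurable_funX; exact: measurable_funB.
  under eq_integral => x _ do rewrite gee0_abs ?lee_fin ?sqr_ge0//.
  by apply: le_lt_trans h1 _; exact: ltry.
have Lv : L2 mu D v.
  have [N1 h1] := Ldv 1 ltr01.
  have -> : v = (fun x => -1 * (u N1 x - v x) + u N1 x).
    by apply/funext => x; ring.
  by apply: L2_lin => //; exact: h1.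
exists v => // e e0; have e2 : 0 < e / 2 by exact: divr_gt0.
have [N0 N0P] := key _ e2; exists N0 => n /N0P.
have Lnv : L2 mu D (fun x => u n x - v x).
  have -> : (fun x => u n x - v x) = (fun x => -1 * v x + u n x).
    by apply/funext => x; ring.
  exact: L2_lin.
rewrite (sqE _ Lnv) lee_fin => h1; apply: (le_lt_trans h1); lra.
Unshelve. all: by end_near.
Qed.

Lemma L2mx_complete m n : seq_complete (@L2mx _ _ _ mu D m n) (@L2dot _ _ _ mu D m n).
Proof.
move=> u Lu uC.
have S := subspace_L2mx mu mD m n.
have comp i j : exists v : T -> R, L2 mu D v /\ forall e, 0 < e -> exists N,
    forall k, (N <= k)%N -> \int[mu]_(x in D) (u k x i j - v x) ^+ 2 < e.
  have [|e e0|v Lv vP] := @L2_complete (fun k x => u k x i j).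
  - by move=> k; exact: Lu.
  - have [N NP] := uC e e0; exists N => k l Nk Nl.
    apply: le_lt_trans (NP k l Nk Nl).
    have Lkl : L2mx mu D (u k - u l) by exact: (subspaceB S).
    have Iij := L2_integrable_mul mD (Lkl i j) (Lkl i j).
    apply: le_Rintegral => //; last 2 first.
    + exact: L2mx_integrable_frob.
    + move=> x _; have := frob_entry_le ((u k - u l) x) i j.
      by rewrite !mxE.
    + apply: eq_integrable Iij => // x _ /=.
      by rewrite !mxE expr2.
  - by exists v.
have /choice[v vP] : forall p : 'I_m * 'I_n, exists v : T -> R, L2 mu D v /\
    forall e, 0 < e -> exists N, forall k, (N <= k)%N ->
    \int[mu]_(x in D) (u k x p.1 p.2 - v x) ^+ 2 < e.
  by move=> [i j]; exact: comp.
pose V x : 'M[R]_(m, n) := \matrix_(i, j) v (i, j) x.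
have LV : L2mx mu D V.
  move=> i j; rewrite (_ : (fun x => V x i j) = v (i, j)); first exact: (vP (i, j)).1.
  by apply/funext => x; rewrite mxE.
exists V => // e e0.
(* The [+ 1] keeps [K] positive for empty matrices and makes the final inequality strict. *)
pose K : R := (m * n)%:R + 1.
have K0 : 0 < K by rewrite ltr_wpDl.
have eK : 0 < e / K by exact: divr_gt0.
have /choice[N NP] : forall p : 'I_m * 'I_n, exists N, forall k, (N <= k)%N ->
    \int[mu]_(x in D) (u k x p.1 p.2 - v p x) ^+ 2 < e / K.
  by move=> p; exact: (vP p).2.
exists (\max_p N p)%N => k Nk.
have LkV : L2mx mu D (u k - V) by exact: (subspaceB S).
rewrite L2dot_sum//.
apply: (@le_lt_trans _ _ (\sum_(i < m) \sum_(j < n) e / K)).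
  apply: ler_sum => i _; apply: ler_sum => j _.
  have Nij : (N (i, j) <= k)%N by apply: leq_trans Nk; exact: leq_bigmax.
  apply: le_trans (ltW (NP (i, j) k Nij)); rewrite le_eqVlt; apply/orP; left.
  by apply/eqP; apply: eq_Rintegral => x _; rewrite !mxE expr2.
rewrite !sumr_const !card_ord -mulrnA -mulr_natl.
rewrite mulrCA -[ltRHS]mulr1 ltr_pM2l// ltr_pdivrMr// mul1r /K mulnC; lra.
Qed.

End L2_complete.

(** * Boxes in R^3 *)

Section space.
Variable R : realType.
Implicit Types (x y a b : R3 R) (j : 'I_3).

Definition coord j (x : R3 R) : R :=
  if j == 0%N :> nat then x.1.1 else if j == 1%N :> nat then x.1.2 else x.2.

Lemma forall_I3 (P : 'I_3 -> Prop) :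
  P (inord 0) -> P (inord 1) -> P (inord 2) -> forall j, P j.
Proof.
move=> P0 P1 P2 [[|[|[|//]]] j3].
- by have -> // : Ordinal j3 = inord 0; apply/val_inj; rewrite /= inordK.
- by have -> // : Ordinal j3 = inord 1; apply/val_inj; rewrite /= inordK.
- by have -> // : Ordinal j3 = inord 2; apply/val_inj; rewrite /= inordK.
Qed.

Lemma coord0 x : coord (inord 0) x = x.1.1. Proof. by rewrite /coord inordK. Qed.
Lemma coord1 x : coord (inord 1) x = x.1.2. Proof. by rewrite /coord inordK. Qed.
Lemma coord2 x : coord (inord 2) x = x.2. Proof. by rewrite /coord inordK. Qed.
Definition coordE := (coord0, coord1, coord2).

Lemma coordD j x y : coord j (x + y) = coord j x + coord j y.
Proof. by rewrite /coord; case: ifP => // _; case: ifP. Qed.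

Lemma coordZ j (c : R) x : coord j (c *: x) = c * coord j x.
Proof. by rewrite /coord; case: ifP => // _; case: ifP. Qed.

Lemma coord_basis j k : coord j (basis3 R k) = (j == k)%:R.
Proof.
rewrite /coord /basis3 /= -val_eqE /=.
by case: j => -[|[|[|//]]] ?; case: k => -[|[|[|//]]] ?.
Qed.

Lemma ball_coord x (e : R) y :
  ball x e y <-> forall j, `|coord j x - coord j y| < e.
Proof.
split=> [[[/= h0 h1] h2]|h].
  by apply: forall_I3; rewrite !coordE.
split; [split|] => /=.
- by have := h (inord 0); rewrite !coordE.
- by have := h (inord 1); rewrite !coordE.
- by have := h (inord 2); rewrite !coordE.
Qed.

Lemma coord_le_norm j x : `|coord j x| <= `|x|.
Proof.
have h1 : `|x.1| <= `|x| by rewrite /Num.norm /= le_max lexx.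
have h2 : `|x.2| <= `|x| by rewrite /Num.norm /= le_max lexx orbT.
rewrite /coord; case: ifP => _.
  by apply: le_trans h1; rewrite {2}/Num.norm /= le_max lexx.
case: ifP => _ //.
by apply: le_trans h1; rewrite {2}/Num.norm /= le_max lexx orbT.
Qed.

Lemma continuous_coord j : continuous (coord j).
Proof.
move=> x; apply/cvgrPdist_lt => e e0.
have : nbhs x (ball x e) by apply/nbhs_ballP; exists e.
by apply: filterS => y /ball_coord.
Qed.

Definition box a b := [set x : R3 R | forall j, coord j a < coord j x < coord j b].

Definition cbox a b := [set x : R3 R | forall j, coord j a <= coord j x <= coord j b].

Lemma boxE a b : box a b =
  (`]a.1.1, b.1.1[ `*` `]a.1.2, b.1.2[) `*` `]a.2, b.2[.
Proof.
apply/seteqP; split=> x.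
  move=> h; split; [split|]; rewrite /= in_itv /=.
  - by have := h (inord 0); rewrite !coordE.
  - by have := h (inord 1); rewrite !coordE.
  - by have := h (inord 2); rewrite !coordE.
by move=> [[/=]]; rewrite !in_itv /= => h0 h1 h2; apply: forall_I3; rewrite !coordE.
Qed.

Lemma cboxE a b : cbox a b =
  (`[a.1.1, b.1.1] `*` `[a.1.2, b.1.2]) `*` `[a.2, b.2].
Proof.
apply/seteqP; split=> x.
  move=> h; split; [split|]; rewrite /= in_itv /=.
  - by have := h (inord 0); rewrite !coordE.
  - by have := h (inord 1); rewrite !coordE.
  - by have := h (inord 2); rewrite !coordE.
by move=> [[/=]]; rewrite !in_itv /= => h0 h1 h2; apply: forall_I3; rewrite !coordE.
Qed.

Lemma sub_box_cbox a b : box a b `<=` cbox a b.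
Proof. by move=> x h j; have /andP[h1 h2] := h j; rewrite !ltW. Qed.

Lemma measurable_box a b : measurable (box a b).
Proof.
by rewrite boxE; apply: measurableX; [apply: measurableX|]; exact: measurable_itv.
Qed.

Lemma measurable_cbox a b : measurable (cbox a b).
Proof.
by rewrite cboxE; apply: measurableX; [apply: measurableX|]; exact: measurable_itv.
Qed.

Lemma compact_cbox a b : compact (cbox a b).
Proof.
by rewrite cboxE; apply: compact_setX; [apply: compact_setX|]; exact: segment_compact.
Qed.

Lemma leb3_prod (A B C : set (measurableTypeR R)) :
  measurable A -> measurable B -> measurable C ->
  leb3 R ((A `*` B) `*` C) =
  (lebesgue_measure A * lebesgue_measure B * lebesgue_measure C)%E.
Proof.
move=> mA mB mC; rewrite -(product_measure1E lebesgue_measure lebesgue_measure mA mB).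
exact: (product_measure1E (lebesgue_measure \x lebesgue_measure)%E lebesgue_measure
  (measurableX mA mB) mC).
Qed.

Lemma leb3_cbox_lty a b : (leb3 R (cbox a b) < +oo)%E.
Proof.
rewrite cboxE leb3_prod; try exact: measurable_itv.
rewrite !lebesgue_measure_itv /=.
by do 3! [case: ifP => _]; rewrite ?mule0 ?mul0e// ltry.
Qed.

(** Rational corners leave only countably many boxes. This serves twice: open sets are measurable
    for the product sigma-algebra, and a property that holds a.e. on each such box holds a.e. on the
    open set. *)
Lemma open_has_box (A : set (R3 R)) x : open A -> A x ->
  exists p q : rat * rat * rat,
   let r (p : rat * rat * rat) : R3 R := (ratr p.1.1, ratr p.1.2, ratr p.2) in
   box (r p) (r q) x /\ cbox (r p) (r q) `<=` A.
Proof.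
move=> oA Ax; have /nbhs_ballP[e /= e0 eA] : nbhs x A by exact: open_nbhs_nbhs.
have lo j : exists q : rat, coord j x - e < ratr q < coord j x.
  have [|q] := @rat_in_itvoo _ (coord j x - e) (coord j x); first lra.
  by rewrite in_itv /=; exists q.
have hi j : exists q : rat, coord j x < ratr q < coord j x + e.
  have [|q] := @rat_in_itvoo _ (coord j x) (coord j x + e); first lra.
  by rewrite in_itv /=; exists q.
have [[p0 h0] [p1 h1] [p2 h2]] := And3 (lo (inord 0)) (lo (inord 1)) (lo (inord 2)).
have [[q0 k0] [q1 k1] [q2 k2]] := And3 (hi (inord 0)) (hi (inord 1)) (hi (inord 2)).
exists (p0, p1, p2), (q0, q1, q2); split.
  move: h0 h1 h2 k0 k1 k2; rewrite !coordE => h0 h1 h2 k0 k1 k2.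
  by apply: forall_I3; rewrite !coordE /=; lra.
move=> y hy; apply: eA; apply/ball_coord; move: hy h0 h1 h2 k0 k1 k2.
rewrite /cbox /= => hy.
have := hy (inord 0); have := hy (inord 1); have := hy (inord 2).
rewrite !coordE /= => y2 y1 y0 h0 h1 h2 k0 k1 k2.
apply: forall_I3; rewrite !coordE; apply/ltr_normlP; split; lra.
Qed.

Lemma open_measurable3 (A : set (R3 R)) : open A -> measurable A.
Proof.
move=> oA.
pose r (p : rat * rat * rat) : R3 R := (ratr p.1.1, ratr p.1.2, ratr p.2).
pose F (pq : (rat * rat * rat) * (rat * rat * rat)) :=
  if `[< cbox (r pq.1) (r pq.2) `<=` A >] then box (r pq.1) (r pq.2) else set0.
have -> : A = \bigcup_pq F pq.
  apply/seteqP; split=> [x Ax|x [pq _]].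
    have [p [q [xpq sub]]] := open_has_box oA Ax.
    by exists (p, q) => //; rewrite /F; case: asboolP.
  rewrite /F; case: asboolP => // sub /sub_box_cbox; exact: sub.
apply: countable_bigcupT_measurable; first exact: countableP.
by move=> pq; rewrite /F; case: ifP => // _; exact: measurable_box.
Qed.

Lemma continuous_measurable3 (f : R3 R -> R) : continuous f -> measurable_fun setT f.
Proof.
move=> cf; apply: (measurability _ (RGenOInfty.measurableE R)).
move=> _ [_ [c ->] <-]; rewrite setTI; apply: open_measurable3.
have /continuousP := cf; apply.
by rewrite set_itvE; exact: open_gt.
Qed.

Definition boxes := [set A | exists a b, A = box a b].

Definition cube (c : R) : R3 R := (c, c, c).

Lemma coord_cube j c : coord j (cube c) = c.
Proof. by rewrite /coord; case: ifP => // _; case: ifP. Qed.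

Lemma cube_cover x : exists n : nat, forall j, `|coord j x| < n%:R.
Proof.
exists (Num.bound `|x|) => j; apply: le_lt_trans (coord_le_norm j x) _.
exact: archi_boundP.
Qed.

(** The inclusion of the closed boxes ensures that bumps on the intersection are still test
    functions whenever [cbox a b] lies in the domain. *)
Lemma box_setI a b a' b' : exists a2 b2,
  box a b `&` box a' b' = box a2 b2 /\ cbox a2 b2 `<=` cbox a b.
Proof.
exists (Num.max a.1.1 a'.1.1, Num.max a.1.2 a'.1.2, Num.max a.2 a'.2).
exists (Num.min b.1.1 b'.1.1, Num.min b.1.2 b'.1.2, Num.min b.2 b'.2).
split; last first.
  move=> x h; have := h (inord 0); have := h (inord 1); have := h (inord 2).
  by rewrite !coordE /= !ge_max !le_min => h1 h2 h3; apply: forall_I3; rewrite !coordE; lra.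
apply/seteqP; split=> x.
  move=> [h h']; have := h (inord 0); have := h (inord 1); have := h (inord 2).
  have := h' (inord 0); have := h' (inord 1); have := h' (inord 2).
  rewrite !coordE => h1 h2 h3 h4 h5 h6; apply: forall_I3; rewrite !coordE /= gt_max lt_min; lra.
move=> h; have := h (inord 0); have := h (inord 1); have := h (inord 2).
rewrite !coordE /= !gt_max !lt_min => h1 h2 h3.
by split; apply: forall_I3; rewrite !coordE; lra.
Qed.

Lemma boxes_setI : setI_closed boxes.
Proof.
move=> _ _ [a [b ->]] [a' [b' ->]]; have [a2 [b2 [-> _]]] := box_setI a b a' b'.
by exists a2, b2.
Qed.

(** An open half-space []c, +oo[] in one coordinate is a countable union of boxes, so the
    coordinates, and hence the identity, are measurable for the sigma-algebra generated by boxes.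
    Together with stability under intersection this prepares Dynkin's lemma. *)
Lemma measurable_boxes : @measurable _ (R3 R) = <<s boxes >>.
Proof.
apply/seteqP; split; last first.
  apply: smallest_sub; first exact: sigma_algebra_measurable.
  by move=> _ [a [b ->]]; exact: measurable_box.
have mc j : @measurable_fun _ _ (g_sigma_algebraType boxes) (measurableTypeR R) setT (coord j).
  apply: (measurability _ (RGenOInfty.measurableE R)).
  move=> _ [_ [c ->] <-]; rewrite setTI.
  have -> : coord j @^-1` `]c, +oo[ = \bigcup_n box
     ((if j == 0%N :> nat then c else - n%:R),
      (if j == 1%N :> nat then c else - n%:R),
      (if j == 2%N :> nat then c else - n%:R)) (cube n%:R).
    apply/seteqP; split=> [x|x [n _ h]].
      rewrite /= in_itv /= andbT => cx; have [n xn] := cube_cover x.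
      exists n => // k; rewrite coord_cube; have /ltr_normlP[h1 h2] := xn k.
      rewrite h2 andbT; move: k j cx h1 {h2}.
      by apply: forall_I3 => j cx h1; move: cx h1;
         move: j; apply: forall_I3; rewrite !coordE /= !inordK//=; lra.
    rewrite /= in_itv /= andbT; have /andP[] := h j.
    move: j {h}; apply: forall_I3; rewrite !coordE /= !inordK//=.
  apply: bigcupT_measurable => n; apply: sub_sigma_algebra.
  by eexists; eexists; reflexivity.
have mid : @measurable_fun _ _ (g_sigma_algebraType boxes) (R3 R) setT id.
  rewrite (_ : id = fun x => (coord (inord 0) x, coord (inord 1) x, coord (inord 2) x)).
    by apply: measurable_fun_pair => //; exact: measurable_fun_pair.
  by apply/funext => -[[x0 x1] x2]; rewrite !coordE.
by move=> A mA; have := mid measurableT A mA; rewrite setTI.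
Qed.

End space.

(** * Bump functions and the uniqueness of weak derivatives *)

Section is_derive_line.
Variables (R : realType) (V W : normedModType R).
Implicit Types f : V -> W.

(** Both difference quotients are the same function of the increment. The equivalence carries the
    chain rule, the mean value theorem and the fundamental theorem of calculus from the line to
    directional derivatives. *)
Lemma is_derive_line f x v t d :
  is_derive (x + t *: v) v f d <-> is_derive t 1 (fun h : R => f (x + h *: v)) d.
Proof.
have E : (fun h : R => h^-1 *: ((f \o shift (x + t *: v)) (h *: v) - f (x + t *: v))) =
    (fun h : R => h^-1 *: (((fun h : R => f (x + h *: v)) \o shift t) (h *: 1) -
       f (x + t *: v))).
  apply/funext => h /=; rewrite scalerDl [h *: 1]mulr1.
  by rewrite addrCA.
split; case=> dd dv; constructor.
- by move: dd; rewrite /derivable E.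
- by move: dv; rewrite /derive E.
- by move: dd; rewrite /derivable E.
- by move: dv; rewrite /derive E.
Qed.

End is_derive_line.

Lemma is_derive_affine (R : realType) (c d t : R) :
  is_derive t (1 : R) (fun h : R => c + h * d) d.
Proof.
have -> : (fun h : R => c + h * d) = cst c + d *: id.
  by apply/funext => h; rewrite !fctE mulrC.
apply: (is_derive_eq (is_deriveD (is_derive_cst c t 1) (is_deriveZ d (is_derive_id t 1)))).
by rewrite add0r [_ *: 1]mulr1.
Qed.

Section expinv.
Variable R : realType.
Implicit Types (P : {poly R}) (t : R).

(* The functions P(1/t) exp(-1/t), extended by 0 to t <= 0, are stable under
   differentiation; bumps built from them are therefore C^oo. *)
Definition expinv P t := if 0 < t then P.[t^-1] * expR (- t^-1) else 0.

(** Induction on the polynomial: half of the rate absorbs the quotient by ['X], the other half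
    absorbs the new factor through [s <= 2 / r * expR (r / 2 * s)]. *)
Lemma poly_le_expR P (r : R) : 0 < r ->
  exists C, forall s, 0 <= s -> `|P.[s]| <= C * expR (r * s).
Proof.
elim/poly_ind: P r => [|P c IH] r r0.
  by exists 0 => s _; rewrite horner0 normr0 mul0r.
have r20 : 0 < r / 2 by exact: divr_gt0.
have [C PC] := IH _ r20; exists (C * (2 / r) + `|c|) => s s0.
rewrite hornerD hornerM hornerX hornerC; apply: le_trans (ler_normD _ _) _.
rewrite mulrDl; apply: lerD; last first.
  by rewrite ler_peMr// -expR0 ler_expR mulr_ge0// ltW.
have C0 : 0 <= C.
  by have := PC 0 (lexx _); rewrite mulr0 expR0 mulr1; apply: le_trans.
rewrite normrM (ger0_norm s0).
have -> : r * s = r / 2 * s + r / 2 * s by field.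
rewrite expRD [leRHS](_ : _ = C * expR (r / 2 * s) * (2 / r * expR (r / 2 * s))); last by ring.
apply: ler_pM => //; first exact: PC.
rewrite -ler_pdivrMl ?divr_gt0// invf_div.
by apply: le_trans (expR_ge1Dx _); rewrite ler_wpDl.
Qed.

Lemma expinv_is_derive0 P : is_derive (0 : R) (1 : R) (expinv P) (0 : R).
Proof.
have L : h^-1 *: ((expinv P \o shift 0) (h *: 1) - expinv P 0) @[h --> 0^'] --> (0 : R).
  have r2 : 0 < 2^-1 :> R by rewrite invr_gt0.
  (* For [h > 0] the difference quotient is [P * 'X] at [h^-1] times [expR (- h^-1)]. Spending rate
     1/2 on the polynomial leaves [C * expR (- (2^-1 * h^-1))], which is at most [2 * C * h]. *)
  have [C PC] := poly_le_expR (P * 'X) r2.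
  have C0 : 0 <= C.
    by have := PC 0 (lexx _); rewrite mulr0 expR0 mulr1; apply: le_trans.
  apply/cvgrPdist_le => e e0; near=> h.
  rewrite sub0r normrN /= addr0 [h *: 1]mulr1 {2}/expinv ltxx subr0.
  rewrite /expinv; case: ifP => hp; last by rewrite scaler0 normr0 ltW.
  have hi : 0 <= h^-1 by rewrite invr_ge0 ltW.
  have := PC _ hi; rewrite hornerM hornerX => H1.
  have -> : h^-1 *: (P.[h^-1] * expR (- h^-1)) = P.[h^-1] * h^-1 * expR (- h^-1).
    by rewrite [_ *: _]mulrCA mulrA.
  rewrite normrM (ger0_norm (expR_ge0 _)).
  apply: (@le_trans _ _ (C * expR (2^-1 * h^-1) * expR (- h^-1))).
    by apply: ler_wpM2r => //; exact: expR_ge0.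
  rewrite -mulrA -expRD.
  have -> : 2^-1 * h^-1 - h^-1 = - (2^-1 * h^-1) by field; rewrite gt_eqF.
  rewrite expRN.
  apply: (@le_trans _ _ (C * (2 * h))).
    apply: ler_wpM2l => //; rewrite -[leRHS]invrK lef_pV2 ?posrE ?expR_gt0 ?invr_gt0 ?mulr_gt0//.
    by rewrite invfM; apply: le_trans (expR_ge1Dx _); rewrite ler_wpDl.
  (* The denominator has [C + 1] because [C] may be 0. *)
  have hd : h <= e / (2 * (C + 1)).
    rewrite -[leLHS](ger0_norm (ltW hp)).
    near: h; apply: dnbhs0_le; rewrite divr_gt0// mulr_gt0//; lra.
  apply: (@le_trans _ _ (C * (2 * (e / (2 * (C + 1)))))).
    by rewrite ler_wpM2l// ler_wpM2l.
  have C10 : 0 < C + 1 by lra.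
  have -> : C * (2 * (e / (2 * (C + 1)))) = e * (C / (C + 1)) by field; rewrite gt_eqF.
  by rewrite ler_piMr ?ltW// ltr_pdivrMr// mul1r ltrDl.
by constructor; [apply/cvg_ex; exists 0|exact/cvg_lim].
Unshelve. all: by end_near.
Qed.

Lemma is_derive_expinv P t : is_derive t 1 (expinv P) (expinv ('X^2 * (P - P^`())) t).
Proof.
have [t0|t0|<-] := ltgtP 0 t.
- have tn : t != 0 by rewrite gt_eqF.
  rewrite [in X in is_derive _ _ _ X]/expinv t0.
  apply: (@near_eq_is_derive _ _ _ (fun s : R => P.[s^-1] * expR (- s^-1))).
    near=> s; rewrite /expinv; have -> // : 0 < s.
    by near: s; exact: lt_nbhsr.
  have DV : is_derive t 1 (fun s : R => s^-1) (- t ^- 2).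
    apply: is_derive_eq; first by apply: is_deriveV => //; exact: is_derive_id.
    by rewrite [_ *: 1]mulr1.
  have DP : is_derive t 1 (fun s : R => P.[s^-1]) (P^`().[t^-1] * - t ^- 2).
    exact: (is_derive1_comp (f := horner P) (is_derive_poly _ _) DV).
  have DVN : is_derive t 1 (fun s : R => - s^-1) (t ^- 2).
    by rewrite -[t ^- 2]opprK; exact: is_deriveN.
  have DE : is_derive t 1 (fun s : R => expR (- s^-1)) (expR (- t^-1) * t ^- 2).
    exact: (is_derive1_comp (f := expR) (is_derive_expR _) DVN).
  apply: (is_derive_eq (is_deriveM DP DE)).
  rewrite hornerM hornerXn hornerD hornerN /GRing.scale /= exprVn; ring.
- rewrite /expinv ltNge (ltW t0) /=.
  apply: (@near_eq_is_derive _ _ _ (cst 0 : R -> R)).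
  near=> s; rewrite ltNge.
  have sl0 : s < 0 by near: s; exact: lt_nbhsl.
  by rewrite ltW.
- by rewrite /expinv ltxx; exact: expinv_is_derive0.
Unshelve. all: by end_near.
Qed.

Lemma continuous_expinv P : continuous (expinv P).
Proof.
move=> t; apply: differentiable_continuous; apply/derivable1_diffP.
by case: (is_derive_expinv P t).
Qed.

End expinv.

Section smooth_alg.
Variable R : realType.
Implicit Types (f g : R3 R -> R) (P : {poly R}) (a b x v : R3 R).

(** [Cinfty] quantifies over all iterated directional derivatives. This class contains the bumps and
    is stable under each directional derivative, so one induction on the list of directions settles
    every order. *)
Inductive smooth_alg : (R3 R -> R) -> Prop :=
| smooth_alg_cst (c : R) : smooth_alg (fun=> c)
| smooth_alg_expinv P j (s c : R) : smooth_alg (fun x => expinv P (s * (coord j x - c)))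
| smooth_algD f g : smooth_alg f -> smooth_alg g -> smooth_alg (fun x => f x + g x)
| smooth_algM f g : smooth_alg f -> smooth_alg g -> smooth_alg (fun x => f x * g x).

Lemma is_derive_coord j x v : is_derive x v (coord j) (coord j v).
Proof.
have -> : x = (x - 0 *: v) + 0 *: v by rewrite subrK.
apply/is_derive_line; rewrite scale0r subr0.
under [X in is_derive _ _ X]eq_fun do rewrite coordD coordZ.
exact: is_derive_affine.
Qed.

Lemma smooth_alg_is_derive f : smooth_alg f -> forall v,
  exists2 g, smooth_alg g & forall x, is_derive x v f (g x).
Proof.
elim=> [c|P j s c|{}f g sf If sg Ig|{}f g sf If sg Ig] v.
- exists (fun=> 0); first exact: smooth_alg_cst.
  by move=> x; exact: is_derive_cst.
- exists (fun x => s * coord j v * expinv ('X^2 * (P - P^`())) (s * (coord j x - c))).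
    by apply: smooth_algM; [exact: smooth_alg_cst|exact: smooth_alg_expinv].
  move=> x; rewrite -[x in is_derive x](addr0 x) -[X in x + X](scale0r v).
  apply/is_derive_line.
  have D : is_derive (0 : R) (1 : R) (fun h : R => s * (coord j (x + h *: v) - c)) (s * coord j v).
    rewrite (_ : (fun h => _) = (fun h : R => s * (coord j x - c) + h * (s * coord j v))).
      exact: is_derive_affine.
    by apply/funext => h; rewrite coordD coordZ; ring.
  have := is_derive1_comp (is_derive_expinv P _) D.
  by rewrite scale0r addr0 mulrC.
- have [f' sf' Df] := If v; have [g' sg' Dg] := Ig v.
  exists (fun x => f' x + g' x); first exact: smooth_algD.
  by move=> x; exact: is_deriveD.
- have [f' sf' Df] := If v; have [g' sg' Dg] := Ig v.
  exists (fun x => f x * g' x + g x * f' x).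
    by apply: smooth_algD; exact: smooth_algM.
  by move=> x; exact: is_deriveM.
Qed.

Lemma smooth_alg_continuous f : smooth_alg f -> continuous f.
Proof.
elim=> [c|P j s c|{}f g sf If sg Ig|{}f g sf If sg Ig] x.
- exact: cvg_cst.
- apply: (@continuous_comp _ _ _ (fun x => s * (coord j x - c)) (expinv P)).
    apply: cvgM; first exact: cvg_cst.
    by apply: cvgB; [exact: continuous_coord|exact: cvg_cst].
  exact: continuous_expinv.
- by apply: cvgD; [exact: If|exact: Ig].
- by apply: cvgM; [exact: If|exact: Ig].
Qed.

Lemma smooth_alg_Cinfty f : smooth_alg f -> Cinfty f.
Proof.
move=> sf s; suff sD : smooth_alg (Defs.iterD s f).
  split; last exact: smooth_alg_continuous.
  by move=> x v; have [g _ /(_ x)[]] := smooth_alg_is_derive sD v.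
elim: s => //= v s IH; have [g sg Dg] := smooth_alg_is_derive IH v.
by rewrite (_ : 'D_v _ = g)//; apply/funext => x; apply: derive_val.
Qed.

Lemma smooth_alg_prod (I : Type) (s : seq I) (F : I -> R3 R -> R) :
  (forall i, smooth_alg (F i)) -> smooth_alg (fun x => \prod_(i <- s) F i x).
Proof.
move=> sF; elim: s => [|i s IH].
  by under eq_fun do rewrite big_nil; exact: smooth_alg_cst.
by under eq_fun do rewrite big_cons; exact: smooth_algM.
Qed.

(** The scale [n.+1] steepens all flanks: the bumps keep values in $[0,1]$ and tend pointwise to the
    indicator of the open box, as dominated convergence requires. *)
Definition bump (n : nat) a b : R3 R -> R := fun x => \prod_(j < 3)
  (expinv 1 (n.+1%:R * (coord j x - coord j a)) *
   expinv 1 (- n.+1%:R * (coord j x - coord j b))).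

Lemma bump_Cinfty n a b : Cinfty (bump n a b).
Proof.
apply/smooth_alg_Cinfty/smooth_alg_prod => j.
by apply: smooth_algM; exact: smooth_alg_expinv.
Qed.

Lemma expinv1_bounds (t : R) : 0 <= expinv 1 t <= 1.
Proof.
rewrite /expinv; case: ifP => [t0|]; last by rewrite lexx ler01.
by rewrite hornerC mul1r expR_ge0 -expR0 ler_expR oppr_le0 invr_ge0 ltW.
Qed.

Lemma bump_bounds n a b x : 0 <= bump n a b x <= 1.
Proof.
rewrite /bump; apply/andP; split.
  apply: prodr_ge0 => j _; apply: mulr_ge0.
    by case/andP: (expinv1_bounds (n.+1%:R * (coord j x - coord j a))).
  by case/andP: (expinv1_bounds (- n.+1%:R * (coord j x - coord j b))).
apply: prodr_ile1 => j _.
have := expinv1_bounds (n.+1%:R * (coord j x - coord j a)).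
have := expinv1_bounds (- n.+1%:R * (coord j x - coord j b)).
move: (expinv _ _) (expinv _ _) => u w /andP[u0 u1] /andP[w0 w1].
by rewrite mulr_ge0//= mulr_ile1.
Qed.

Lemma bump_outside n a b x : ~ box a b x -> bump n a b x = 0.
Proof.
move=> /existsNP[j /negP]; rewrite negb_and -!leNgt => h.
apply/eqP; rewrite /bump; apply/prodf_eq0; exists j => //; rewrite mulf_eq0.
rewrite /expinv; case/orP: h => h.
  rewrite ltNge mulr_ge0_le0 ?eqxx//; by rewrite subr_le0.
rewrite [X in _ || ((if X then _ else _) == 0)]ltNge mulr_le0_ge0 ?eqxx ?orbT//; by rewrite subr_ge0.
Qed.

Lemma expinv1_cvg (t : R) : 0 < t -> expinv 1 (n.+1%:R * t) @[n --> \oo] --> (1 : R).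
Proof.
move=> t0; have -> : (fun n => expinv 1 (n.+1%:R * t)) =
    (fun n => expR (- (t^-1 * n.+1%:R^-1))).
  apply/funext => n; rewrite /expinv mulr_gt0//= hornerC mul1r invfM.
  by rewrite mulrC.
rewrite -[X in _ --> X]expR0; apply: continuous_cvg; first exact: continuous_expR.
rewrite -oppr0; apply: cvgN; rewrite -(mulr0 t^-1).
by apply: cvgM; [exact: cvg_cst|exact: cvg_harmonic].
Qed.

Lemma bump_cvg a b x : bump n a b x @[n --> \oo] --> (\1_(box a b) x : R).
Proof.
rewrite indicE; have [/set_mem xab|/negP xab] := boolP (x \in box a b); last first.
  rewrite (_ : (fun n => _) = cst 0); first exact: cvg_cst.
  by apply/funext => n; apply: bump_outside => h; apply: xab; exact/mem_set.
have step j : expinv 1 (n.+1%:R * (coord j x - coord j a)) *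
    expinv 1 (- n.+1%:R * (coord j x - coord j b)) @[n --> \oo] --> (1 : R).
  have /andP[h1 h2] := xab j.
  rewrite -[X in _ --> X]mulr1; apply: cvgM; first by apply: expinv1_cvg; rewrite subr_gt0.
  under eq_fun do rewrite mulNr -mulrN opprB.
  by apply: expinv1_cvg; rewrite subr_gt0.
rewrite /bump [X in _ --> X](_ : _ = \prod_(j < 3) (1 : R)); last by rewrite big1.
rewrite !big_ord_recl big_ord0.
under eq_fun do rewrite !big_ord_recl big_ord0.
by do 3! (apply: cvgM; first exact: step); exact: cvg_cst.
Qed.

Lemma closed_cbox a b : closed (cbox a b).
Proof. by apply: compact_closed; [exact: norm_hausdorff|exact: compact_cbox]. Qed.

Lemma bump_testfun (Om : set (R3 R)) n a b : cbox a b `<=` Om -> testfun Om (bump n a b).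
Proof.
move=> abO.
have sub : closure [set x | bump n a b x != 0] `<=` cbox a b.
  have /closure_id -> := @closed_cbox a b; apply: closureS => x /= /eqP xn.
  by apply: sub_box_cbox; apply: contrapT => /(bump_outside n).
split; [exact: bump_Cinfty| |exact: subset_trans abO].
by apply: subclosed_compact (@compact_cbox _ a b) sub; exact: closed_closure.
Qed.

End smooth_alg.

(** * The du Bois-Reymond lemma *)

Section fundamental_lemma.
Variable R : realType.
Notation mu := (leb3 R).
Implicit Types (a b : R3 R) (g : R3 R -> R).

Lemma L2_integrable_box (D : set (R3 R)) g a b : measurable D -> L2 mu D g ->
  box a b `<=` D -> mu.-integrable (box a b) (EFin \o g).
Proof.
move=> mD Lg sub; have mB := measurable_box a b.
have Lgb : L2 mu (box a b) g.
  have /(L2P mu mD)[mg Ig] := Lg; apply/(L2P mu mB); split.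
    exact: measurable_funS mg.
  exact: integrableS Ig.
have L1 : L2 mu (box a b) (fun=> 1).
  apply/(L2P mu mB); split=> //; apply: measurable_bounded_integrable => //.
    apply: le_lt_trans (leb3_cbox_lty a b); apply: le_measure; rewrite ?inE//.
      exact: measurable_cbox.
    exact: sub_box_cbox.
  by exists 1; split=> // M M1 x _; rewrite expr1n normr1 ltW.
have := L2_integrable_mul mB Lgb L1.
by apply: eq_integrable => // x _ /=; rewrite mulr1.
Qed.

Variables (Om : set (R3 R)) (g : R3 R -> R).
Hypotheses (oOm : open Om) (Lg : L2 mu Om g).
Hypothesis g_test : forall phi, testfun Om phi -> \int[mu]_(x in Om) (g x * phi x) = 0.

Let mOm : measurable Om. Proof. exact: open_measurable3. Qed.

Let integral_box a b : cbox a b `<=` Om -> (\int[mu]_(x in box a b) (g x)%:E = 0)%E.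
Proof.
move=> abO; have bO : box a b `<=` Om := subset_trans (@sub_box_cbox _ a b) abO.
have mB := measurable_box a b; have Ig := L2_integrable_box mOm Lg bO.
have mg : measurable_fun (box a b) g by apply/measurable_EFinP; case/integrableP: Ig.
have mbump n : measurable_fun (box a b) (bump n a b).
  apply: measurable_funTS; apply: continuous_measurable3.
  by have [_] := bump_Cinfty n a b [::].
have m1 n : measurable_fun (box a b) (fun x => (g x * bump n a b x)%:E).
  by apply/measurable_EFinP; exact: measurable_funM.
have c1 : {ae mu, forall x, box a b x ->
    (fun n => (g x * bump n a b x)%:E) @ \oo --> (g x)%:E}.
  apply: aeW => x xab; apply: cvg_EFin; first by apply: nearW.
  rewrite -[X in _ --> X]mulr1; apply: cvgM; first exact: cvg_cst.
  have -> : 1 = \1_(box a b) x :> R by rewrite indicE mem_set.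
  exact: bump_cvg.
have c2 : {ae mu, forall x n, box a b x ->
    (`|(g x * bump n a b x)%:E| <= `|(g x)%:E|)%E}.
  apply: aeW => x n _; rewrite abse_EFin lee_fin normrM ler_piMr//.
  by have /andP[b0 b1] := bump_bounds n a b x; rewrite ger0_norm.
have mgE : measurable_fun (box a b) (fun x => (g x)%:E) by apply/measurable_EFinP.
have [_ _ cv] := dominated_convergence mB m1 mgE c1 (integrable_abse Ig) c2.
have zero n : (\int[mu]_(x in box a b) (g x * bump n a b x)%:E = 0)%E.
  have E : (\int[mu]_(x in box a b) (g x * bump n a b x)%:E =
      \int[mu]_(x in Om) (g x * bump n a b x)%:E)%E.
    rewrite integral_mkcond [RHS]integral_mkcond; apply: eq_integral => x _.
    rewrite !patchE; have [/set_mem xb|/negP xb] := boolP (x \in box a b).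
      by rewrite mem_set//; exact: bO.
    rewrite bump_outside; first by rewrite mulr0 if_same.
    by move=> h; apply: xb; exact/mem_set.
  have := g_test (bump_testfun n abO); rewrite /Rintegral -E => g0.
  rewrite -[LHS]fineK ?g0//.
  apply: integrable_fin_num => //; apply: le_integrable Ig => //.
  move=> x _; rewrite abse_EFin lee_fin normrM ler_piMr//.
  by have /andP[b0 b1] := bump_bounds n a b x; rewrite ger0_norm.
move: cv; under eq_fun do rewrite zero.
by move/cvg_lim => <-//; exact: lim_cst.
Qed.

(** Inside a fixed box, Dynkin's lemma extends the vanishing of the integral from smaller boxes to
    all Borel subsets, which forces [g] to vanish a.e. there. Countably many rational boxes then
    cover [Om]. *)
Lemma du_bois_reymond : ae_eq mu Om g (cst 0).
Proof.
have boxP (p : (rat * rat * rat) * (rat * rat * rat)) :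
    let r (p : rat * rat * rat) : R3 R := (ratr p.1.1, ratr p.1.2, ratr p.2) in
    cbox (r p.1) (r p.2) `<=` Om -> ae_eq mu (box (r p.1) (r p.2)) g (cst 0).
  move=> r; move: (r p.1) (r p.2) => a b abO {r p}.
  have mB := measurable_box a b.
  have bO : box a b `<=` Om := subset_trans (@sub_box_cbox _ a b) abO.
  have Ig := L2_integrable_box mOm Lg bO.
  have Ig' A : measurable A -> mu.-integrable (box a b `&` A) (EFin \o g).
    move=> mA; by apply: integrableS Ig => //; exact: measurableI.
  have all0 A : <<s @boxes R >> A -> (\int[mu]_(x in box a b `&` A) (g x)%:E = 0)%E.
    apply: (dynkin_induction (G := @boxes R)
      (P := fun A => (\int[mu]_(x in box a b `&` A) (g x)%:E = 0)%E)).
    - exact: measurable_boxes.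
    - exact: boxes_setI.
    - by rewrite setIT; exact: integral_box.
    - move=> _ [a' [b' ->]]; have [a2 [b2 [-> sub]]] := box_setI a b a' b'.
      by apply: integral_box; exact: subset_trans abO.
    - move=> S mS S0.
      have : (\int[mu]_(x in (box a b `&` S) `|` (box a b `&` ~` S)) (g x)%:E = 0)%E.
        by rewrite -setIUr setUCr setIT; exact: integral_box.
      rewrite integral_setU.
      + by rewrite S0 add0e.
      + exact: measurableI.
      + by apply: measurableI => //; exact: measurableC.
      + by rewrite -setIUr setUCr setIT; case/integrableP: Ig.
      + by apply/disj_setPS => x [[_ ?] [_ ?]].
    - move=> F mF tF F0; rewrite setI_bigcupr integral_bigcup.
      + by rewrite eseries0.
      + by apply: trivIset_setIl.
      + by move=> k; apply: measurableI.
      + by rewrite -setI_bigcupr; apply: Ig'; exact: bigcupT_measurable.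
  have : ae_eq mu (box a b) (EFin \o g) (cst 0%E).
    apply: integral_ae_eq => // E Eab mE; rewrite integral0.
    have gE : <<s @boxes R >> E by rewrite -(@measurable_boxes R).
    by rewrite -(setIidr Eab); exact: all0.
  by apply: filterS => x /= h /h[].
pose r (p : rat * rat * rat) : R3 R := (ratr p.1.1, ratr p.1.2, ratr p.2).
(* Pairs of rational corners are enumerated through [pickle], so that the exceptional null sets form
   a sequence. *)
pose Q n x := if unpickle n is Some p then
  cbox (r p.1) (r p.2) `<=` Om -> box (r p.1) (r p.2) x -> g x = 0 else True.
have /ae_foralln : forall n, \forall x \ae mu, Q n x.
  move=> n; rewrite /Q; case: unpickle => [p|]; last exact: aeW.
  have [abO|nab] := pselect (cbox (r p.1) (r p.2) `<=` Om).
    by have := boxP p abO; apply: filterS => x h _; exact: h.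
  by apply: aeW => x /nab.
apply: filterS => x QP Omx; have [p [q [xpq sub]]] := open_has_box oOm Omx.
by have := QP (pickle (p, q)); rewrite /Q pickleK; exact.
Qed.

End fundamental_lemma.

(** * Integration by parts, Poincare and Korn inequalities *)

Section product_integral0.
Context d1 d2 (T1 : measurableType d1) (T2 : measurableType d2) (R : realType).
Variables (m1 : {sigma_finite_measure set T1 -> \bar R})
  (m2 : {sigma_finite_measure set T2 -> \bar R}).
Local Open Scope ereal_scope.

Lemma prod_integral0_snd (f : T1 * T2 -> \bar R) :
  (m1 \x m2).-integrable setT f -> (forall x, \int[m2]_y f (x, y) = 0) ->
  \int[m1 \x m2]_z f z = 0.
Proof.
by move=> If f0; rewrite -(integral12_prod_meas1 If); apply: integral0_eq => x _; exact: f0.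
Qed.

(** The vanishing is asked only of integrable slices: in three dimensions a slice is itself a double
    integral, and applying Fubini to it again requires its integrability. *)
Lemma prod_integral0_fst (f : T1 * T2 -> \bar R) :
  (m1 \x m2).-integrable setT f ->
  (forall y, m1.-integrable setT (fun x => f (x, y)) -> \int[m1]_x f (x, y) = 0) ->
  \int[m1 \x m2]_z f z = 0.
Proof.
move=> If f0; rewrite -(integral21_prod_meas1 If).
rewrite (ae_eq_integral (cst 0))//; first exact: integral0.
  exact: (measurable_fubini_G If).
by have := ae_integrable2 If; apply: filterS => y fy _; exact: f0.
Qed.

End product_integral0.

Section leb2.
Variable R : realType.
Notation lam := (@lebesgue_measure R).

(* A named copy of the product, because the library infers sigma-finiteness of
   m1 \x m2 only when m1 and m2 are subprobabilities. *)
Definition leb2 : set (measurableTypeR R * measurableTypeR R) -> \bar R := (lam \x lam)%E.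

HB.instance Definition _ := Measure.on leb2.

Let leb2_sigma_finite : sigma_finite setT leb2.
Proof.
pose I n : set (measurableTypeR R) := `](- n%:R : R), n%:R[%classic.
exists (fun n => I n `*` I n).
  apply/esym; rewrite -subTset => -[x y] _; exists (Num.bound (`|x| + `|y|)) => //.
  have := archi_boundP (addr_ge0 (normr_ge0 x) (normr_ge0 y)).
  move: (Num.bound _) => n xyn.
  have h (z : R) : `|z| < n%:R -> I n z by rewrite ltr_norml /I /= in_itv.
  by split; apply: h; apply: le_lt_trans xyn; rewrite ?lerDl ?lerDr.
move=> n; have mI : measurable (I n) by exact: measurable_itv.
split; first exact: measurableX.
have lI : (lam (I n) < +oo)%E.
  by rewrite /I lebesgue_measure_itv /=; case: ifP => _; rewrite ltry.
by rewrite /leb2 product_measure1E// lte_mul_pinfty// ge0_fin_numE.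
Qed.

HB.instance Definition _ := Measure_isSigmaFinite.Build _ _ _ leb2 leb2_sigma_finite.

End leb2.

Section line.
Variable R : realType.

Lemma line_integral0 (F g : R -> R) (M : R) :
  (forall t, is_derive t (1 : R) F (g t)) -> continuous g ->
  (forall t, M <= `|t| -> F t = 0) ->
  (\int[lebesgue_measure]_t (g t)%:E = 0)%E.
Proof.
(* [K] lies strictly beyond [M], so [F] vanishes near every [t] with [K <= |t|] and its derivative
   is 0 there as well. *)
move=> Fg cg F0; pose K := `|M| + 1.
have K0 : 0 < K by have := normr_ge0 M; rewrite /K; lra.
have MK : M < K by have := ler_norm M; rewrite /K; lra.
have g0 t : K <= `|t| -> g t = 0.
  move=> Kt; have dF : is_derive t (1 : R) F 0.
    have Mt : M < `|t| by exact: lt_le_trans MK Kt.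
    apply: (@near_eq_is_derive _ _ _ (cst 0 : R -> R)).
    have : \forall s \near t, M < `|s|.
      by apply: (@cvgr_gt _ _ (nbhs t) _ (fun s : R => `|s|) `|t|) => //; exact: norm_continuous.
    by apply: filterS => s Ms; rewrite F0// ltW.
  by rewrite -(derive_val (is_derive := dF)) (derive_val (is_derive := Fg t)).
rewrite (_ : (fun t => (g t)%:E) = (EFin \o g) \_ `[- K, K]); last first.
  apply/funext => t; rewrite patchE; case: ifP => // /negbT; rewrite notin_setE /= in_itv /=.
  move=> h; rewrite g0// leNgt; apply/negP => /ltr_normlP[h1 h2]; apply: h; lra.
rewrite -integral_mkcond (@continuous_FTC2 _ g F).
- by rewrite !F0 ?subee// ?normrN gtr0_norm// ltW.
- lra.
- exact: continuous_subspaceT.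
- have cF : continuous F.
    move=> t; apply: differentiable_continuous; apply/derivable1_diffP.
    by case: (Fg t).
  split; first by move=> t _; case: (Fg t).
  + exact: cvg_at_right_filter (cF _).
  + exact: cvg_at_left_filter (cF _).
- by move=> t _; rewrite derive1E (derive_val (is_derive := Fg t)).
Qed.

End line.

Lemma continuous_line (R : realType) (V : normedModType R) (x v : V) :
  continuous (fun t : R => x + t *: v).
Proof.
move=> t; apply: (@cvgD _ _ _ (nbhs t) _ (cst x) (fun t => t *: v)); first exact: cvg_cst.
exact: cvgZr_tmp.
Qed.

Section compact_support.
Variable R : realType.
Notation mu := (leb3 R).
Notation e_ := (basis3 R).
Implicit Types (x v w : R3 R) (f : R3 R -> R).

Lemma R3_ext x y : (forall j, coord j x = coord j y) -> x = y.
Proof.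
case: x y => [[x0 x1] x2] [[y0 y1] y2] h.
have := h (inord 0); have := h (inord 1); have := h (inord 2).
by rewrite !coordE /= => -> -> ->.
Qed.

Lemma cc_integrable f (M : R) : continuous f ->
  (forall x, (exists k, M < `|coord k x|) -> f x = 0) ->
  mu.-integrable setT (EFin \o f).
Proof.
move=> cf f0; pose K := cbox (cube (- M)) (cube M).
have mK : measurable K := measurable_cbox _ _.
have -> : EFin \o f = (EFin \o f) \_ K.
  apply/funext => x; rewrite patchE; case: ifP => // /negbT; rewrite notin_setE /=.
  move=> /existsNP[k]; rewrite !coord_cube -ler_norml => /negP; rewrite -ltNge => h.
  by rewrite f0//; exists k.
apply/(integrable_mkcond _ mK); apply: measurable_bounded_integrable => //.
- exact: leb3_cbox_lty.
- by apply: measurable_funTS; exact: continuous_measurable3.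
- have : compact (f @` K).
    by apply: continuous_compact; [exact: continuous_subspaceT|exact: compact_cbox].
  move=> /compact_bounded[B [rB hB]]; exists B; split=> // N BN x Kx.
  by apply: hB => //; exists x.
Qed.

Section partial.
Variables (j : 'I_3) (psi : R3 R -> R) (M : R).
Hypotheses (psi_der : forall x, derivable psi x (e_ j))
  (psi_cont : continuous ('D_(e_ j) psi))
  (psi_supp : forall x, (exists k, M <= `|coord k x|) -> psi x = 0).
Local Notation G := ('D_(e_ j) psi).
Local Notation lam := (@lebesgue_measure R).

Lemma partial_supp x : (exists k, M < `|coord k x|) -> G x = 0.
Proof.
move=> [k Mk]; rewrite -[RHS](derive_cst (0 : R) x (e_ j)).
apply: near_eq_derive.
have : \forall y \near x, M < `|coord k y|.
  apply: (@cvgr_gt _ _ (nbhs x) _ (fun y => `|coord k y|) `|coord k x|) => //.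
  by apply: cvg_norm; exact: continuous_coord.
by apply: filterS => y My; rewrite psi_supp//; exists k; exact: ltW.
Qed.

Lemma partial_integrable : mu.-integrable setT (EFin \o G).
Proof. by apply: (@cc_integrable _ M) => // x; exact: partial_supp. Qed.

Lemma partial_line_integral0 x :
  (\int[lebesgue_measure]_t (G (x + t *: e_ j))%:E = 0)%E.
Proof.
apply: (@line_integral0 _ (fun t => psi (x + t *: e_ j)) _ (M + `|coord j x|)).
- move=> t; have D := derivableP (@psi_der (x + t *: e_ j)).
  exact: ((is_derive_line psi x (e_ j) t (G (x + t *: e_ j))).1 D).
- move=> t; apply: (@continuous_comp _ _ _ (fun t : R => x + t *: e_ j) G).
    exact: continuous_line.
  exact: psi_cont.
- move=> t Mt; apply: psi_supp; exists j.
  rewrite coordD coordZ coord_basis eqxx mulr1.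
  have := lerB_normD t (coord j x); rewrite [t + _]addrC; lra.
Qed.

(** Fubini, with the [j]-th variable integrated first. Space is nested as
    $(\mathbb{R}\times\mathbb{R})\times\mathbb{R}$: the last variable is reached by one application,
    the other two by a second one inside the planar slices ([inner]). *)
Lemma partial_integral0 : (\int[mu]_x (G x)%:E = 0)%E.
Proof.
have Gi : (@leb2 R \x lam)%E.-integrable setT (fun x => (G x)%:E) := partial_integrable.
have inner z : (lam \x lam)%E.-integrable setT (fun xy => (G (xy, z))%:E) ->
    j = inord 0 \/ j = inord 1 -> (\int[(lam \x lam)%E]_xy (G (xy, z))%:E = 0)%E.
  move=> Gz [j0|j1].
    apply: prod_integral0_fst Gz _ => y _.
    rewrite -[RHS](partial_line_integral0 (0, y, z)); apply: eq_integral => t _.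
    congr (G _)%:E; apply: R3_ext; apply: forall_I3;
      by rewrite coordD coordZ coord_basis j0 !coordE -val_eqE /= !inordK//=; ring.
  apply: prod_integral0_snd Gz _ => x.
  rewrite -[RHS](partial_line_integral0 (x, 0, z)); apply: eq_integral => t _.
  congr (G _)%:E; apply: R3_ext; apply: forall_I3;
    by rewrite coordD coordZ coord_basis j1 !coordE -val_eqE /= !inordK//=; ring.
(* [leb2] unfolds to the product measure; under this name its sigma-finiteness is declared. *)
suff : (\int[(@leb2 R \x lam)%E]_x (G x)%:E = 0)%E by [].
have : j = inord 0 \/ j = inord 1 \/ j = inord 2.
  by move: (j); apply: forall_I3; tauto.
move=> [j0|[j1|j2]].
- by apply: prod_integral0_fst Gi _ => z Gz; apply: inner Gz _; left.
- by apply: prod_integral0_fst Gi _ => z Gz; apply: inner Gz _; right.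
apply: prod_integral0_snd Gi _ => xy.
rewrite -[RHS](partial_line_integral0 (xy, 0)); apply: eq_integral => t _.
congr (G _)%:E; apply: R3_ext; apply: forall_I3;
  by rewrite coordD coordZ coord_basis j2 !coordE -val_eqE /= !inordK//=; ring.
Qed.

End partial.
End compact_support.

(** * Symmetry of second derivatives *)

Section schwarz.
Variables (R : realType) (V : normedModType R).
Implicit Types (f : V -> R) (v w x : V).

Lemma Cinfty_derivable (W : normedModType R) (f : V -> W) x v : Cinfty f -> derivable f x v.
Proof. by move=> cf; have [h _] := cf [::]; exact: h. Qed.

Lemma Cinfty_continuous (W : normedModType R) (f : V -> W) : Cinfty f -> continuous f.
Proof. by move=> cf; have [_ h] := cf [::]. Qed.

Lemma Cinfty_D (W : normedModType R) (f : V -> W) v : Cinfty f -> Cinfty ('D_v f).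
Proof.
move=> cf s; suff -> : Defs.iterD s ('D_v f) = Defs.iterD (rcons s v) f by exact: cf.
by elim: s => //= w s ->.
Qed.

Lemma Cinfty_lin (a : R) f g : Cinfty f -> Cinfty g -> Cinfty (fun x => a * f x + g x).
Proof.
move=> cf cg s.
have -> : Defs.iterD s (fun x => a * f x + g x) =
    a *: Defs.iterD s f + Defs.iterD s g.
  elim: s => //= v s ->; apply/funext => x.
  have [df _] := cf s; have [dg _] := cg s.
  by rewrite deriveD ?deriveZ//; exact: derivableZ.
have [df ccf] := cf s; have [dg ccg] := cg s; split=> [x v|x].
  by apply: derivableD => //; exact: derivableZ.
by apply: cvgD; [apply: cvgZl_tmp; exact: ccf|exact: ccg].
Qed.

(** The mean value theorem is applied in direction [v] and then in direction [w]. The second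
    difference is symmetric in [v] and [w], so exchanging them expresses the same number by the
    other mixed derivative. *)
Lemma second_difference f v w x (h : R) : Cinfty f -> 0 < h ->
  exists s t, [/\ 0 < s < h, 0 < t < h &
    f (x + h *: v + h *: w) - f (x + h *: v) - (f (x + h *: w) - f x) =
    h ^+ 2 * 'D_w ('D_v f) (x + s *: v + t *: w)].
Proof.
move=> cf h0.
have cDv : Cinfty ('D_v f) := Cinfty_D v cf.
pose g s := f (x + h *: w + s *: v) - f (x + s *: v).
pose dg s := 'D_v f (x + h *: w + s *: v) - 'D_v f (x + s *: v).
have Dg (s : R) : is_derive s (1 : R) g (dg s).
  apply: is_deriveB.
    by apply: (is_derive_line f (x + h *: w) v s _).1; apply/derivableP/Cinfty_derivable.
  by apply: (is_derive_line f x v s _).1; apply/derivableP/Cinfty_derivable.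
have cg : continuous g.
  by move=> s; apply: differentiable_continuous; apply/derivable1_diffP; case: (Dg s).
have [//|s] := MVT h0 (fun s _ => Dg s); first exact: continuous_subspaceT.
rewrite in_itv /= => sh; rewrite /g !scale0r !addr0 subr0 => E1.
pose k t := 'D_v f (x + s *: v + t *: w).
have Dk (t : R) : is_derive t (1 : R) k ('D_w ('D_v f) (x + s *: v + t *: w)).
  by apply: (is_derive_line ('D_v f) (x + s *: v) w t _).1; apply/derivableP/Cinfty_derivable.
have ck : continuous k.
  by move=> t; apply: differentiable_continuous; apply/derivable1_diffP; case: (Dk t).
have [//|t] := MVT h0 (fun t _ => Dk t); first exact: continuous_subspaceT.
rewrite in_itv /= => th; rewrite /k scale0r addr0 subr0 => E2.
exists s, t; split=> //.
rewrite [x + h *: v + _]addrAC E1 /dg [x + h *: w + _]addrAC E2; ring.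
Qed.

Lemma eq_of_nearby_values (F G : V -> R) x : continuous F -> continuous G ->
  (forall d, 0 < d -> exists y z, [/\ `|x - y| < d, `|x - z| < d & F y = G z]) ->
  F x = G x.
Proof.
move=> cF cG FG; apply/eqP; rewrite -subr_eq0 -normr_eq0 eq_le normr_ge0 andbT.
apply/ler_addgt0Pr => e e0; rewrite add0r.
have e2 : 0 < e / 2 by exact: divr_gt0.
have nF : nbhs x [set y | `|F x - F y| < e / 2].
  by move/cvgrPdist_lt: (cF x); exact.
have nG : nbhs x [set y | `|G x - G y| < e / 2].
  by move/cvgrPdist_lt: (cG x); exact.
move: nF nG => /nbhs_normP[d1 d10 B1] /nbhs_normP[d2 d20 B2].
have d0 : 0 < Num.min d1 d2 by rewrite lt_min d10.
have [y [z [yd zd E]]] := FG _ d0.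
have b1 : `|F x - F y| < e / 2.
  by apply: B1; apply: lt_le_trans yd _; rewrite ge_min lexx.
have b2 : `|G x - G z| < e / 2.
  by apply: B2; apply: lt_le_trans zd _; rewrite ge_min lexx orbT.
rewrite E in b1; have -> : F x - G x = (F x - G z) - (G x - G z) by ring.
apply: le_trans (ler_normB _ _) _; lra.
Qed.

Lemma schwarz f v w x : Cinfty f -> 'D_w ('D_v f) x = 'D_v ('D_w f) x.
Proof.
move=> cf; apply: (eq_of_nearby_values (Cinfty_continuous (Cinfty_D w (Cinfty_D v cf)))
  (Cinfty_continuous (Cinfty_D v (Cinfty_D w cf)))) => d d0.
(* The summand 1 covers [v = w = 0]. With [h = d / K] both intermediate points lie within [d] of
   [x]. *)
pose K := `|v| + `|w| + 1; have K0 : 0 < K by rewrite ltr_wpDl// addr_ge0.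
pose h := d / K; have h0 : 0 < h by exact: divr_gt0.
have near_x s t a b : 0 < s < h -> 0 < t < h -> `|a| + `|b| = `|v| + `|w| ->
    `|x - (x + s *: a + t *: b)| < d.
  move=> /andP[s0 sh] /andP[t0 th] ab.
  rewrite -addrA opprD addrA subrr sub0r normrN.
  apply: le_lt_trans (ler_normD _ _) _; rewrite !normrZ (gtr0_norm s0) (gtr0_norm t0).
  apply: (@le_lt_trans _ _ (h * (`|a| + `|b|))).
    by rewrite mulrDr; apply: lerD; apply: ler_wpM2r => //; exact: ltW.
  have -> : d = h * K by rewrite /h divfK// gt_eqF.
  by rewrite ltr_pM2l// ab /K ltrDl.
have [s1 [t1 [s1h t1h E1]]] := second_difference v w x cf h0.
have [s2 [t2 [s2h t2h E2]]] := second_difference w v x cf h0.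
exists (x + s1 *: v + t1 *: w), (x + s2 *: w + t2 *: v); split.
- exact: near_x.
- by apply: near_x => //; rewrite addrC.
- have h2 : h ^+ 2 != 0 by rewrite expf_neq0// gt_eqF.
  have E : h ^+ 2 * 'D_w ('D_v f) (x + s1 *: v + t1 *: w) =
           h ^+ 2 * 'D_v ('D_w f) (x + s2 *: w + t2 *: v).
    apply: (etrans (esym E1)); apply: (etrans _ E2).
    have -> : f (x + h *: w + h *: v) = f (x + h *: v + h *: w).
      by congr f; exact: addrAC.
    ring.
  exact: (mulfI h2 E).
Qed.

End schwarz.

Section test_functions.
Variable R : realType.
Notation mu := (leb3 R).
Notation e_ := (basis3 R).
Implicit Types (x v w : R3 R) (f g : R3 R -> R) (Om : set (R3 R)).

Definition compactly_supported f :=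
  exists M, forall x, (exists k, M <= `|coord k x|) -> f x = 0.

Lemma compactly_supportedMl f g : compactly_supported f ->
  compactly_supported (fun x => f x * g x).
Proof. by move=> [M fM]; exists M => x /fM ->; rewrite mul0r. Qed.

Lemma compactly_supported_integrable f : continuous f -> compactly_supported f ->
  mu.-integrable setT (EFin \o f).
Proof.
move=> cf [M fM]; apply: (@cc_integrable _ f M) => // x [k Mk].
by apply: fM; exists k; exact: ltW.
Qed.

Lemma testfun_supported Om f : testfun Om f -> compactly_supported f.
Proof.
(* The norm is bounded by every number above [B], such as [B + 1]; the threshold [B + 2] is strictly
   larger. *)
move=> [_ /compact_bounded[B [rB hB]] _]; exists (B + 2) => x [k Bk].
apply/eqP; apply: contraT => fx.
have := hB (B + 1); rewrite ltrDl ltr01 => /(_ isT x).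
have xc : closure [set x | f x != 0] x by exact: subset_closure.
move=> /(_ xc) => xB; have := coord_le_norm k x; move: xB => /= xB; lra.
Qed.

Lemma testfun_outside Om f x : testfun Om f -> ~ Om x -> f x = 0.
Proof.
move=> [_ _ sub] nOm; apply/eqP; apply: contraT => fx; exfalso; apply: nOm.
by apply: sub; exact: subset_closure.
Qed.

Lemma testfun_continuous Om f : testfun Om f -> continuous f.
Proof. by case=> cf _ _; exact: Cinfty_continuous. Qed.

Lemma testfun_derivable Om f x v : testfun Om f -> derivable f x v.
Proof. by case=> cf _ _; exact: Cinfty_derivable. Qed.

Lemma testfun_D Om f v : testfun Om f -> testfun Om ('D_v f).
Proof.
move=> [cf cpt sub].
have h : closure [set x | 'D_v f x != 0] `<=` closure [set x | f x != 0].
  have cl : closed (closure [set x | f x != 0]) by exact: closed_closure.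
  rewrite [X in _ `<=` X](closure_id _).1//; apply: closureS => x /= Dx.
  apply: contrapT => nx; move/eqP: Dx; apply.
  rewrite -[RHS](derive_cst (0 : R) x v); apply: near_eq_derive.
  have : nbhs x (~` closure [set x | f x != 0]).
    by apply: open_nbhs_nbhs; split=> //; exact: closed_openC.
  apply: filterS => y ny; apply/eqP; apply: contraT => fy; exfalso; apply: ny.
  exact: subset_closure.
split; [exact: Cinfty_D| |exact: subset_trans sub].
by apply: subclosed_compact cpt h; exact: closed_closure.
Qed.

Lemma testfun_lin Om (a : R) f g : testfun Om f -> testfun Om g ->
  testfun Om (fun x => a * f x + g x).
Proof.
move=> [cf kf sf] [cg kg sg].
have h : closure [set x | a * f x + g x != 0] `<=`
    closure [set x | f x != 0] `|` closure [set x | g x != 0].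
  rewrite -closureU; apply: closureS => x /= n0.
  have [fx|fx] := eqVneq (f x) 0; last by left.
  by right; move: n0; rewrite fx mulr0 add0r.
split; first exact: Cinfty_lin.
  by apply: subclosed_compact (compactU kf kg) h; exact: closed_closure.
by apply: subset_trans h _; rewrite subUset.
Qed.

Lemma testfun0 Om : testfun Om (fun=> 0 : R).
Proof.
have E : closure [set x : R3 R | (0 : R) != 0] = set0.
  by rewrite (_ : [set x | _] = set0) ?closure0//; apply/seteqP; split=> x //=; rewrite eqxx.
split; [|by rewrite E; exact: compact0|by rewrite E].
exact: smooth_alg_Cinfty (smooth_alg_cst 0).
Qed.

Lemma Rintegral_supported Om f : (forall x, ~ Om x -> f x = 0) ->
  \int[mu]_(x in Om) f x = \int[mu]_x f x.
Proof.
move=> f0; rewrite Rintegral_mkcond; apply: eq_Rintegral => x _; rewrite patchE.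
by case: ifPn => //; rewrite notin_setE => /f0.
Qed.

Lemma testfun_L2 Om f : measurable Om -> testfun Om f -> L2 mu Om f.
Proof.
move=> mOm tf; have cf := testfun_continuous tf; apply/(L2P mu mOm); split.
  by apply: measurable_funTS; exact: continuous_measurable3.
apply: (@integrableS _ _ _ mu setT) => //.
apply: compactly_supported_integrable.
  by move=> x; apply: cvgM; exact: cf.
exact: compactly_supportedMl (testfun_supported tf).
Qed.

(** The product inherits the compact support of [f], so the integral of its derivative vanishes. *)
Lemma integral_partialM j f g : Cinfty f -> Cinfty g -> compactly_supported f ->
  \int[mu]_x (f x * 'D_(e_ j) g x) = - \int[mu]_x ('D_(e_ j) f x * g x).
Proof.
move=> cf cg sf.
have df x : derivable f x (e_ j) by exact: Cinfty_derivable.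
have dg x : derivable g x (e_ j) by exact: Cinfty_derivable.
have cDf := Cinfty_continuous (Cinfty_D (e_ j) cf).
have cDg := Cinfty_continuous (Cinfty_D (e_ j) cg).
have {}cf := Cinfty_continuous cf; have {}cg := Cinfty_continuous cg.
have DE : 'D_(e_ j) (f * g) = fun x => f x * 'D_(e_ j) g x + 'D_(e_ j) f x * g x.
  by apply/funext => x; rewrite deriveM// [g x *: _]mulrC.
have c1 : continuous (fun x => f x * 'D_(e_ j) g x).
  by move=> x; apply: cvgM; [exact: cf|exact: cDg].
have c2 : continuous (fun x => 'D_(e_ j) f x * g x).
  by move=> x; apply: cvgM; [exact: cDf|exact: cg].
have s1 : compactly_supported (fun x => f x * 'D_(e_ j) g x).
  exact: compactly_supportedMl.
have [M sM] := sf.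
have s2 : compactly_supported (fun x => 'D_(e_ j) f x * g x).
  (* The derivative is known to vanish only strictly beyond [M]. *)
  apply: compactly_supportedMl; exists (M + 1) => x [k Mk].
  by apply: (partial_supp j sM); exists k; lra.
have psi0 x : (exists k, M <= `|coord k x|) -> (f * g) x = 0.
  by move=> /sM fx; have -> : (f * g) x = f x * g x by []; rewrite fx mul0r.
have cDE : continuous ('D_(e_ j) (f * g)).
  by rewrite DE => x; apply: cvgD; [exact: c1|exact: c2].
have dfg x : derivable (f * g) x (e_ j) by exact: derivableM.
have := @partial_integral0 R j (f * g) M dfg cDE psi0.
under eq_integral => x _ do rewrite (congr1 (@^~ x) DE) /=.
move=> I0.
apply/eqP; rewrite -addr_eq0; apply/eqP.
rewrite -RintegralD//; last 2 first.
- exact: compactly_supported_integrable.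
- exact: compactly_supported_integrable.
by rewrite /Rintegral I0.
Qed.

Lemma testfun_is_wpartial Om j f : measurable Om -> testfun Om f ->
  is_wpartial Om j f ('D_(e_ j) f).
Proof.
move=> mOm tf; split; first by apply: testfun_L2 => //; exact: testfun_D.
move=> phi tphi.
rewrite (@Rintegral_supported Om (fun x => f x * 'D_(e_ j) phi x)); last first.
  by move=> x nx; rewrite (testfun_outside tf nx) mul0r.
rewrite (@Rintegral_supported Om (fun x => 'D_(e_ j) f x * phi x)); last first.
  by move=> x nx; rewrite (testfun_outside tphi nx) mulr0.
by apply: integral_partialM; [case: tf|case: tphi|exact: testfun_supported tf].
Qed.

(* The integral of d_j (x_j f^2) = f^2 + 2 x_j f d_j f vanishes. *)
Lemma poincare_testfun Om (B : R) j f : (forall x, Om x -> `|coord j x| <= B) ->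
  testfun Om f ->
  \int[mu]_(x in Om) f x ^+ 2 <= 4 * B ^+ 2 * \int[mu]_(x in Om) 'D_(e_ j) f x ^+ 2.
Proof.
move=> hB tf; pose Df := 'D_(e_ j) f.
have tDf : testfun Om Df := testfun_D (e_ j) tf.
have cf := testfun_continuous tf; have cD := testfun_continuous tDf.
have sf := testfun_supported tf; have sD := testfun_supported tDf.
rewrite (@Rintegral_supported Om (fun x => f x ^+ 2)); last first.
  by move=> x nx; rewrite (testfun_outside tf nx) expr0n.
rewrite (@Rintegral_supported Om (fun x => 'D_(e_ j) f x ^+ 2)); last first.
  move=> x nx; have -> : 'D_(e_ j) f x = 0 := testfun_outside tDf nx.
  by rewrite expr0n.
pose G x := coord j x * (2 * f x * Df x) + f x ^+ 2.
have DG : 'D_(e_ j) (coord j * (f * f)) = G.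
  have df x : derivable f x (e_ j) by exact: testfun_derivable tf.
  have dc x : derivable (coord j) x (e_ j) by case: (is_derive_coord j x (e_ j)).
  apply/funext => x; rewrite deriveM//; last exact: derivableM.
  rewrite deriveM// (derive_val (is_derive := is_derive_coord j x (e_ j))).
  rewrite coord_basis eqxx /G /GRing.scale /=.
  have -> : (f * f) x = f x * f x by [].
  rewrite -/(Df x); ring.
have cG : continuous G.
  move=> x; apply: cvgD; last by apply: cvgM; exact: cf.
  apply: cvgM; first exact: continuous_coord.
  by apply: cvgM; [apply: cvgM; [exact: cvg_cst|exact: cf]|exact: cD].
have [M sM] := sf.
have sG : compactly_supported G by exists M => x /sM fx; rewrite /G fx; ring.
have G0 : \int[mu]_x G x = 0.
  rewrite /Rintegral -DG (@partial_integral0 R j _ M)//.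
  - move=> x; apply: derivableM; first by case: (is_derive_coord j x (e_ j)).
    by apply: derivableM; exact: testfun_derivable tf.
  - by rewrite DG.
  - move=> x /sM fx; have -> : (coord j * (f * f)) x = coord j x * (f x * f x) by [].
    by rewrite fx; ring.
have If : mu.-integrable setT (EFin \o (fun x => f x ^+ 2)).
  apply: compactly_supported_integrable; first by move=> x; apply: cvgM; exact: cf.
  exact: compactly_supportedMl.
have ID : mu.-integrable setT (EFin \o (fun x => Df x ^+ 2)).
  apply: compactly_supported_integrable; first by move=> x; apply: cvgM; exact: cD.
  exact: compactly_supportedMl.
have IG : mu.-integrable setT (EFin \o G) by exact: compactly_supported_integrable.
have IfZ : mu.-integrable setT (EFin \o (fun x => 2^-1 * f x ^+ 2)).
  exact: (integrableZl measurableT _ If).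
have IDZ : mu.-integrable setT (EFin \o (fun x => 2 * B ^+ 2 * Df x ^+ 2)).
  exact: (integrableZl measurableT _ ID).
(* The pointwise inequality is half of [0 <= (f x + 2 * coord j x * Df x) ^+ 2] with the coordinate
   bounded by [B]. As [G] integrates to 0, the factors 1/2 and [2 * B ^+ 2] produce the constant
   [4 * B ^+ 2]. *)
have : \int[mu]_x (2^-1 * f x ^+ 2) <= \int[mu]_x (G x + 2 * B ^+ 2 * Df x ^+ 2).
  apply: le_Rintegral => //; first exact: (integrableD measurableT IG IDZ).
  move=> x _; have [Omx|nOm] := pselect (Om x); last first.
    by rewrite /G (testfun_outside tf nOm) (testfun_outside tDf nOm); lra.
  have xB : coord j x ^+ 2 <= B ^+ 2.
    rewrite -[leLHS](real_normK (num_real _)); apply: lerXn2r; rewrite ?nnegrE//.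
      by apply: le_trans (hB x Omx).
    exact: hB.
  have := sqr_ge0 (f x + 2 * coord j x * Df x); have := sqr_ge0 (Df x).
  rewrite /G; move: (f x) (Df x) (coord j x) xB => a b c; nra.
rewrite RintegralD// G0 add0r RintegralZl// RintegralZl//; lra.
Qed.

Definition classical_Jac (phi : R3 R -> 'cV[R]_3) (x : R3 R) : 'M[R]_3 :=
  \matrix_(i, j) 'D_(e_ j) (fun y => phi y i 0) x.

(* Two integrations by parts turn the integral of d_j phi_i d_i phi_j into that of
   d_i phi_i d_j phi_j, whose sum over i and j is the integral of (div phi)^2. *)
Lemma korn_testfun Om (phi : R3 R -> 'cV[R]_3) : measurable Om ->
  (forall i, testfun Om (fun x => phi x i 0)) ->
  L2dot mu Om (classical_Jac phi) (classical_Jac phi) <=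
  2 * L2dot mu Om (fun x => sympart (classical_Jac phi x))
                  (fun x => sympart (classical_Jac phi x)).
Proof.
move=> mOm tphi; pose J := classical_Jac phi.
have tJ i j : testfun Om (fun x => J x i j).
  by under [X in testfun _ X]eq_fun do rewrite mxE; exact: testfun_D.
(* Row [i] of [A] is constantly [J x i i], so [A] against its transpose gives the products
   [J x i i * J x j j], whose sum is the square of the trace. *)
pose A x : 'M[R]_3 := \matrix_(i, j) J x i i.
have LJ : L2mx mu Om J by move=> i j; exact: testfun_L2.
have LJT : L2mx mu Om (fun x => (J x)^T).
  by move=> i j; under [X in L2 _ _ X]eq_fun do rewrite mxE; exact: testfun_L2.
have LA : L2mx mu Om A.
  by move=> i j; under [X in L2 _ _ X]eq_fun do rewrite mxE; exact: testfun_L2.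
have LAT : L2mx mu Om (fun x => (A x)^T).
  by move=> i j; under [X in L2 _ _ X]eq_fun do rewrite 2!mxE; exact: testfun_L2.
have cross i j : \int[mu]_(x in Om) (J x i j * (J x)^T i j) =
    \int[mu]_(x in Om) (A x i j * (A x)^T i j).
  rewrite (@Rintegral_supported Om (fun x => J x i j * (J x)^T i j)); last first.
    by move=> x nx; rewrite (testfun_outside (tJ i j) nx) mul0r.
  rewrite (@Rintegral_supported Om (fun x => A x i j * (A x)^T i j)); last first.
    by move=> x nx; rewrite mxE (testfun_outside (tJ i i) nx) mul0r.
  pose u := (fun y => phi y i 0); pose w := (fun y => phi y j 0).
  have Cu : Cinfty u by case: (tphi i).
  have Cw : Cinfty w by case: (tphi j).
  transitivity (\int[mu]_x ('D_(e_ j) u x * 'D_(e_ i) w x)).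
    by apply: eq_Rintegral => x _; rewrite !mxE.
  transitivity (\int[mu]_x ('D_(e_ i) u x * 'D_(e_ j) w x)); last first.
    by apply: eq_Rintegral => x _; rewrite !mxE.
  have Sj := testfun_supported (testfun_D (e_ j) (tphi i)).
  have Si := testfun_supported (testfun_D (e_ i) (tphi i)).
  apply: (etrans (integral_partialM i (Cinfty_D (e_ j) Cu) Cw Sj)).
  apply: (etrans _ (esym (integral_partialM j (Cinfty_D (e_ i) Cu) Cw Si))).
  have E x : 'D_(e_ i) ('D_(e_ j) u) x = 'D_(e_ j) ('D_(e_ i) u) x by exact: schwarz.
  by apply: (congr1 (fun r => - r)); apply: eq_Rintegral => x _; rewrite E.
have crossE : L2dot mu Om J (fun x => (J x)^T) = L2dot mu Om A (fun x => (A x)^T).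
  rewrite !L2dot_sum//; apply: eq_bigr => i _; apply: eq_bigr => j _; exact: cross.
have cross_ge0 : 0 <= L2dot mu Om J (fun x => (J x)^T).
  rewrite crossE; apply: Rintegral_ge0 => x _.
  rewrite (_ : frob _ _ = (\sum_i J x i i) ^+ 2) ?sqr_ge0//.
  rewrite frobE expr2 mulr_suml; apply: eq_bigr => i _; rewrite mulr_sumr.
  by apply: eq_bigr => j _; rewrite !mxE.
have IJ := L2mx_integrable_frob mOm LJ LJ.
have IJT := L2mx_integrable_frob mOm LJ LJT.
(* The squared norm of the symmetric part is half of $|J|^2 + \langle J, J^T\rangle$. Dropping the
   nonnegative cross term yields Korn's constant 2. *)
have -> : L2dot mu Om (fun x => sympart (J x)) (fun x => sympart (J x)) =
    2^-1 * (L2dot mu Om J J + L2dot mu Om J (fun x => (J x)^T)).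
  rewrite /L2dot -RintegralD// -RintegralZl//; last exact: (integrableD mOm IJ IJT).
  apply: eq_Rintegral => x _; rewrite frob_sympart ?sympart_sym// frobC /sympart.
  rewrite frobC -[_ *: _]addr0 frobDl -[X in X + _^T]scale1r frobDl.
  have -> : frob (0 : 'M[R]_3) (J x) = 0 by rewrite /frob mul0mx mxtrace0.
  by rewrite addr0 mul1r (frobC _^T).
lra.
Qed.

End test_functions.

(** * The spaces H^1 and H^1_0 *)

Section ae_invariance.
Context d (T : measurableType d) (R : realType).
Variables (mu : {measure set T -> \bar R}) (D : set T).
Hypothesis mD : measurable D.

Lemma L2dot_ae_eq m n (F F' G : T -> 'M[R]_(m, n)) :
  L2mx mu D F -> L2mx mu D F' -> L2mx mu D G ->
  {ae mu, forall x, D x -> F x = F' x} -> L2dot mu D F G = L2dot mu D F' G.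
Proof.
move=> LF LF' LG FF; rewrite /L2dot /Rintegral; congr fine.
have /integrableP[m1 _] := L2mx_integrable_frob mD LF LG.
have /integrableP[m2 _] := L2mx_integrable_frob mD LF' LG.
by apply: ae_eq_integral => //; apply: filterS FF => x h Dx; rewrite h.
Qed.

(** [L] will be the weak Jacobian or its symmetric part. These are linear only almost everywhere,
    because weak derivatives are chosen representatives, and the integral does not see the
    difference. *)
Lemma semi_inner_L2dot_comp (V : lmodType R) (S : set V) m n
    (L : V -> T -> 'M[R]_(m, n)) :
  subspace S -> (forall v, S v -> L2mx mu D (L v)) ->
  (forall a u v, S u -> S v ->
     {ae mu, forall x, D x -> L (a *: u + v) x = a *: L u x + L v x}) ->
  semi_inner S (fun u v => L2dot mu D (L u) (L v)).
Proof.
move=> subS LL lin; have [sym linl pos] := @semi_inner_L2dot _ _ _ mu D mD m n.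
split=> [u v Su Sv|w Sw a u v Su Sv|u Su]; [by apply: sym; exact: LL| |by apply: pos; exact: LL].
rewrite -linl//; try exact: LL.
apply: L2dot_ae_eq; try exact: LL; last exact: lin.
  by apply: LL; apply subS.
by apply: (subspace_L2mx mu mD m n).2; exact: LL.
Qed.

(** The almost everywhere form is called for by the stress, which is symmetric only off a null set,
    so that positive definiteness applies only there. *)
Lemma Rintegral_ae_le (f g : T -> R) :
  mu.-integrable D (EFin \o f) -> mu.-integrable D (EFin \o g) ->
  {ae mu, forall x, D x -> f x <= g x} ->
  \int[mu]_(x in D) f x <= \int[mu]_(x in D) g x.
Proof.
move=> If Ig fg; rewrite -subr_ge0 -RintegralB//.
have Id := integrableB mD Ig If; have /integrableP[md _] := Id.
rewrite [leRHS](_ : _ = \int[mu]_(x in D) `|g x - f x|).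
  by apply: Rintegral_ge0 => x _; exact: normr_ge0.
rewrite /Rintegral; congr fine; apply: ae_eq_integral => //.
  by apply/measurable_EFinP; apply: measurableT_comp => //; apply/measurable_EFinP.
by apply: filterS fg => x h Dx /=; rewrite ger0_norm// subr_ge0 h.
Qed.

End ae_invariance.

Section sobolev_spaces.
Variables (R : realType) (Om : set (R3 R)).
Hypothesis oOm : open Om.
Notation mu := (leb3 R).
Notation e_ := (basis3 R).
Implicit Types (u v w : R3 R -> 'cV[R]_3) (f g : R3 R -> R).

Let mOm : measurable Om. Proof. exact: open_measurable3. Qed.

Lemma integrable_testfun f phi : L2 mu Om f -> testfun Om phi ->
  mu.-integrable Om (EFin \o (fun x => f x * phi x)).
Proof. by move=> Lf tphi; apply: L2_integrable_mul => //; exact: testfun_L2. Qed.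

Lemma is_wpartial_lin j (a : R) f1 f2 g1 g2 : L2 mu Om f1 -> L2 mu Om f2 ->
  is_wpartial Om j f1 g1 -> is_wpartial Om j f2 g2 ->
  is_wpartial Om j (fun x => a * f1 x + f2 x) (fun x => a * g1 x + g2 x).
Proof.
move=> Lf1 Lf2 [Lg1 h1] [Lg2 h2]; split; first exact: L2_lin.
have key f f' psi : L2 mu Om f -> L2 mu Om f' -> testfun Om psi ->
    \int[mu]_(x in Om) ((a * f x + f' x) * psi x) =
    a * \int[mu]_(x in Om) (f x * psi x) + \int[mu]_(x in Om) (f' x * psi x).
  move=> Lf Lf' tpsi.
  have I1 := integrable_testfun Lf tpsi; have I2 := integrable_testfun Lf' tpsi.
  rewrite -RintegralZl// -RintegralD//; last exact: (integrableZl mOm a I1).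
  by apply: eq_Rintegral => x _; rewrite mulrDl mulrA.
move=> phi tphi; have tD := testfun_D (e_ j) tphi.
by rewrite key// key// h1// h2//; ring.
Qed.

Lemma is_wpartial_unique j f g1 g2 : is_wpartial Om j f g1 -> is_wpartial Om j f g2 ->
  {ae mu, forall x, Om x -> g1 x = g2 x}.
Proof.
move=> [Lg1 h1] [Lg2 h2].
have Ld : L2 mu Om (fun x => -1 * g2 x + g1 x) by exact: L2_lin.
have := du_bois_reymond oOm Ld _.
have dtest phi : testfun Om phi -> \int[mu]_(x in Om) ((-1 * g2 x + g1 x) * phi x) = 0.
  move=> tphi; have I1 := integrable_testfun Lg1 tphi; have I2 := integrable_testfun Lg2 tphi.
  have := h1 _ tphi; rewrite h2// => /oppr_inj E.
  transitivity (\int[mu]_(x in Om) (g1 x * phi x - g2 x * phi x)).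
    by apply: eq_Rintegral => x _; ring.
  by rewrite RintegralB// E subrr.
move=> /(_ dtest); apply: filterS => x h Omx; have := h Omx => /= E; lra.
Qed.

Lemma wpartialP j f : (exists g, is_wpartial Om j f g) ->
  is_wpartial Om j f (wpartial Om j f).
Proof. by move=> [g fg]; apply: (@xgetPex _ _ [set g | is_wpartial Om j f g]); exists g. Qed.

Lemma wpartial_ae_eq j f g : is_wpartial Om j f g ->
  {ae mu, forall x, Om x -> wpartial Om j f x = g x}.
Proof. by move=> fg; apply: (is_wpartial_unique _ fg); apply: wpartialP; exists g. Qed.

Lemma H1mx_L2 v : H1mx Om v -> L2mx mu Om v.
Proof. by move=> Hv i j; have [] := Hv i j. Qed.

Lemma Jac_is_wpartial v i j : H1mx Om v ->
  is_wpartial Om j (fun x => v x i 0) (fun x => Jac Om v x i j).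
Proof.
move=> Hv; have [_ /(_ j) h] := Hv i 0; under [X in is_wpartial _ _ _ X]eq_fun do rewrite mxE.
exact: wpartialP.
Qed.

Lemma Jac_L2 v : H1mx Om v -> L2mx mu Om (Jac Om v).
Proof. by move=> Hv i j; have [] := Jac_is_wpartial i j Hv. Qed.

Lemma ae_all_entries (I : finType) (P : I -> R3 R -> Prop) :
  (forall i, {ae mu, forall x, Om x -> P i x}) ->
  {ae mu, forall x, Om x -> forall i, P i x}.
Proof.
move=> h; have : {ae mu, forall x, forall i, Om x -> P i x} by exact: filter_forall.
by apply: filterS => x hx Omx i; exact: hx.
Qed.

Lemma Jac_ae_eq v (G : R3 R -> 'M[R]_3) :
  (forall i j, is_wpartial Om j (fun x => v x i 0) (fun x => G x i j)) ->
  {ae mu, forall x, Om x -> Jac Om v x = G x}.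
Proof.
move=> h; have : {ae mu, forall x, Om x -> forall p : 'I_3 * 'I_3,
    Jac Om v x p.1 p.2 = G x p.1 p.2}.
  apply: ae_all_entries => -[i j] /=; have := wpartial_ae_eq (h i j).
  by apply: filterS => x hx Omx; rewrite mxE hx.
by apply: filterS => x hx Omx; apply/matrixP => i j; exact: (hx Omx (i, j)).
Qed.

Lemma Jac_lin_wpartial (a : R) u v i j : H1mx Om u -> H1mx Om v ->
  is_wpartial Om j (fun x => (a *: u + v) x i 0)
    (fun x => (a *: Jac Om u x + Jac Om v x) i j).
Proof.
move=> Hu Hv.
under [X in is_wpartial _ _ X]eq_fun do rewrite !mxE.
under [X in is_wpartial _ _ _ X]eq_fun do rewrite 2!mxE.
by apply: is_wpartial_lin; [case: (Hu i 0)|case: (Hv i 0)|exact: Jac_is_wpartial|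
  exact: Jac_is_wpartial].
Qed.

Lemma Jac_lin (a : R) u v : H1mx Om u -> H1mx Om v ->
  {ae mu, forall x, Om x -> Jac Om (a *: u + v) x = a *: Jac Om u x + Jac Om v x}.
Proof. by move=> Hu Hv; apply: Jac_ae_eq => i j; exact: Jac_lin_wpartial. Qed.

Lemma subspace_H1 : subspace [set v : R3 R -> 'cV[R]_3 | H1mx Om v].
Proof.
split=> [i k|a u v Hu Hv i k].
  rewrite (_ : (fun x => _) = fun=> 0); last by apply/funext => x; rewrite mxE.
  split; first exact: L2_cst0.
  move=> j; exists ('D_(e_ j) (fun=> 0 : R)).
  by apply: testfun_is_wpartial => //; exact: testfun0.
rewrite ord1; split=> [|j]; last by eexists; exact: Jac_lin_wpartial.
exact: (subspace_L2mx mu mOm 3 1).2 (H1mx_L2 Hu) (H1mx_L2 Hv) i 0.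
Qed.

Definition H1dot u v := L2dot mu Om u v + L2dot mu Om (Jac Om u) (Jac Om v).

Definition strain_dot u v := L2dot mu Om (fun x => sympart (Jac Om u x))
  (fun x => sympart (Jac Om v x)).

Lemma H1normE v : H1norm Om v = Num.sqrt (H1dot v v).
Proof.
by rewrite /H1norm /H1dot /L2dot; congr (Num.sqrt (_ + _));
  apply: eq_Rintegral => x _; rewrite fnorm_sqr.
Qed.

Lemma sympart_L2 (F : R3 R -> 'M[R]_3) : L2mx mu Om F ->
  L2mx mu Om (fun x => sympart (F x)).
Proof.
move=> LF i j; rewrite (_ : (fun x => _) =
    fun x => 2^-1 * F x i j + (2^-1 * F x j i + 0)).
  by apply: L2_lin => //; apply: L2_lin => //; exact: L2_cst0.
by apply/funext => x; rewrite !mxE; ring.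
Qed.

Let subH1 := subspace_H1.

Lemma semi_inner_Jac : semi_inner [set v | H1mx Om v]
  (fun u v => L2dot mu Om (Jac Om u) (Jac Om v)).
Proof.
apply: (semi_inner_L2dot_comp mOm subH1) => [v Hv|a u v Hu Hv]; first exact: Jac_L2.
exact: Jac_lin.
Qed.

Lemma semi_inner_H1dot : semi_inner [set v | H1mx Om v] H1dot.
Proof.
have [s1 l1 p1] := @semi_inner_L2dot _ _ _ mu Om mOm 3 1.
have [s2 l2 p2] := semi_inner_Jac.
split=> [u v Hu Hv|w Hw a u v Hu Hv|u Hu].
- exact: congr2 (s1 _ _ (H1mx_L2 Hu) (H1mx_L2 Hv)) (s2 _ _ Hu Hv).
- have E1 := l1 _ (H1mx_L2 Hw) a u v (H1mx_L2 Hu) (H1mx_L2 Hv).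
  have E2 := l2 _ Hw a u v Hu Hv.
  by apply: (etrans (congr2 +%R E1 E2)); rewrite /H1dot mulrDr addrACA.
- exact: addr_ge0 (p1 _ (H1mx_L2 Hu)) (p2 _ Hu).
Qed.

Lemma semi_inner_strain : semi_inner [set v | H1mx Om v] strain_dot.
Proof.
apply: (semi_inner_L2dot_comp mOm subH1 (L := fun v x => sympart (Jac Om v x))).
  by move=> v Hv; apply: sympart_L2; exact: Jac_L2.
move=> a u v Hu Hv; have := Jac_lin a Hu Hv.
by apply: filterS => x h Omx; rewrite h// sympartDl.
Qed.

Lemma L2dot_le_H1dot v : H1mx Om v -> L2dot mu Om v v <= H1dot v v.
Proof. by move=> Hv; rewrite /H1dot lerDl; have [_ _] := semi_inner_Jac; exact. Qed.

Lemma L2dot_Jac_le_H1dot v : H1mx Om v ->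
  L2dot mu Om (Jac Om v) (Jac Om v) <= H1dot v v.
Proof.
move=> Hv; rewrite /H1dot lerDr.
by have [_ _] := @semi_inner_L2dot _ _ _ mu Om mOm 3 1; apply; exact: H1mx_L2.
Qed.

(** The symmetric part [S] of [X] is an orthogonal projection: $|X|^2 = |S|^2 + |X - S|^2$. The
    bound makes the strain norm continuous in $H^1$, as needed to pass coercivity to the closure. *)
Lemma strain_le_H1dot v : H1mx Om v -> strain_dot v v <= H1dot v v.
Proof.
move=> Hv; apply: le_trans (L2dot_Jac_le_H1dot Hv); have LJ := Jac_L2 Hv.
apply: le_Rintegral => //.
- by apply: L2mx_integrable_frob => //; exact: sympart_L2.
- exact: L2mx_integrable_frob.
move=> x _; set X := Jac Om v x; have := frob_sympart X (sympart_sym X).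
move: (sympart X) => S SX; have := frob_ge0 (- 1 *: S + X).
rewrite frobDl (frobC S (_ + _)) (frobC X (_ + _)) !frobDl (frobC X S); lra.
Qed.

(** The fields and their Jacobians converge separately in $L^2$. The identity defining weak
    derivatives passes to the limit, so the limit [G] is a weak Jacobian of [v] and agrees a.e. with
    the chosen one. *)
Lemma H1_complete : seq_complete [set v | H1mx Om v] H1dot.
Proof.
move=> u Hu uC.
have Hd m n : H1mx Om (u m - u n) by exact: (subspaceB subH1).
have [//|v Lv uv] := @L2mx_complete _ _ _ mu Om mOm 3 1 u (fun n => H1mx_L2 (Hu n)).
  move=> e e0; have [N NP] := uC e e0; exists N => m n Nm Nn.
  by apply: le_lt_trans (NP m n Nm Nn); exact: L2dot_le_H1dot.
have JB m n : {ae mu, forall x, Om x ->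
    Jac Om (u m - u n) x = (Jac Om (u m) - Jac Om (u n)) x}.
  have := Jac_lin (-1) (Hu n) (Hu m); apply: filterS => x h Omx.
  by rewrite addrC -scaleN1r h// scaleN1r addrC.
have LJd m n : L2mx mu Om (Jac Om (u m) - Jac Om (u n)).
  exact: (subspaceB (subspace_L2mx mu mOm 3 3) (Jac_L2 (Hu m)) (Jac_L2 (Hu n))).
have [//|G LG uG] := @L2mx_complete _ _ _ mu Om mOm 3 3 (fun n => Jac Om (u n))
    (fun n => Jac_L2 (Hu n)).
  move=> e e0; have [N NP] := uC e e0; exists N => m n Nm Nn.
  apply: le_lt_trans (NP m n Nm Nn); apply: le_trans (L2dot_Jac_le_H1dot (Hd m n)).
  rewrite le_eqVlt; apply/orP; left; apply/eqP.
  have [sym _ _] := @semi_inner_L2dot _ _ _ mu Om mOm 3 3.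
  rewrite -(L2dot_ae_eq mOm (Jac_L2 (Hd m n)) (LJd m n) (LJd m n) (JB m n)).
  rewrite (sym _ _ (Jac_L2 (Hd m n)) (LJd m n)).
  by rewrite -(L2dot_ae_eq mOm (Jac_L2 (Hd m n)) (LJd m n) (Jac_L2 (Hd m n)) (JB m n)).
have wG i j : is_wpartial Om j (fun x => v x i 0) (fun x => G x i j).
  split; first exact: LG.
  move=> phi tphi; have tD := testfun_D (e_ j) tphi.
  have Lphi := testfun_L2 mOm tphi; have LD := testfun_L2 mOm tD.
  (* Multiplying the test function by a matrix unit writes the scalar integrals as values of
     [L2dot], so that Cauchy-Schwarz for matrix fields controls both limits. *)
  pose Phi x : 'M[R]_(3, 3) := phi x *: delta_mx i j.
  pose DPhi x : 'cV[R]_3 := 'D_(e_ j) phi x *: delta_mx i 0.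
  have LPhi : L2mx mu Om Phi.
    move=> k l; rewrite (_ : (fun x => _) =
        fun x => ((k == i) && (l == j))%:R * phi x + 0).
      by apply: L2_lin => //; exact: L2_cst0.
    by apply/funext => x; rewrite !mxE addr0 mulrC.
  have LDPhi : L2mx mu Om DPhi.
    move=> k l; rewrite (_ : (fun x => _) =
        fun x => ((k == i) && (l == 0))%:R * 'D_(e_ j) phi x + 0).
      by apply: L2_lin => //; exact: L2_cst0.
    by apply/funext => x; rewrite !mxE addr0 mulrC.
  have dE m n (F : R3 R -> 'M[R]_(m, n)) (h : R3 R -> R) k l :
      \int[mu]_(x in Om) (F x k l * h x) = L2dot mu Om F (fun x => h x *: delta_mx k l).
    apply: eq_Rintegral => x _; rewrite frobE (bigD1 k)//= (bigD1 l)//= !mxE !eqxx mulr1.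
    rewrite [X in _ + X + _]big1 ?addr0; last first.
      by move=> q /negPf ql; rewrite !mxE ql andbF mulr0 mulr0.
    rewrite [X in _ + X]big1 ?addr0// => p /negPf pk.
    by apply: big1 => q _; rewrite !mxE pk mulr0 mulr0.
  rewrite dE dE -/DPhi -/Phi.
  apply/eqP; rewrite -subr_eq0 opprK; apply/eqP.
  apply: (@le_eps0 _ _ (Num.sqrt (L2dot mu Om DPhi DPhi) + Num.sqrt (L2dot mu Om Phi Phi))).
  move=> e e0; have e2 : 0 < e ^+ 2 by exact: exprn_gt0.
  have [N1 h1] := uv _ e2; have [N2 h2] := uG _ e2; pose n := maxn N1 N2.
  have se a : a < e ^+ 2 -> Num.sqrt a <= e.
    by move=> ae; rewrite -[leRHS](ger0_norm (ltW e0)) -sqrtr_sqr ler_wsqrtr// ltW.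
  have {}h1 := se _ (h1 n (leq_maxl _ _)); have {}h2 := se _ (h2 n (leq_maxr _ _)).
  have [_ wn] := Jac_is_wpartial i j (Hu n).
  have := wn phi tphi; rewrite dE dE -/DPhi -/Phi => un.
  have SB1 := semi_inner_L2dot mu mOm 3 1; have SB3 := semi_inner_L2dot mu mOm 3 3.
  have sub1 := subspace_L2mx mu mOm 3 1; have sub3 := subspace_L2mx mu mOm 3 3.
  have Lun : L2mx mu Om (u n) := H1mx_L2 (Hu n).
  have LJn : L2mx mu Om (Jac Om (u n)) := Jac_L2 (Hu n).
  have Lunv : L2mx mu Om (u n - v) by exact: (subspaceB sub1).
  have LJnG : L2mx mu Om (Jac Om (u n) - G) by exact: (subspaceB sub3).
  have [_ lin1 _] := SB1; have [_ lin3 _] := SB3.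
  have E1 := linear_onB (lin1 _ LDPhi) Lun Lv.
  have E3 := linear_onB (lin3 _ LPhi) LJn LG.
  have C1 := semi_inner_CS_sqrt sub1 SB1 Lunv LDPhi.
  have C3 := semi_inner_CS_sqrt sub3 SB3 LJnG LPhi.
  have -> : L2dot mu Om v DPhi + L2dot mu Om G Phi =
      - (L2dot mu Om (u n - v) DPhi + L2dot mu Om (Jac Om (u n) - G) Phi).
    by rewrite E1 E3 un; ring.
  rewrite normrN mulrDl; apply: le_trans (ler_normD _ _) _; apply: lerD.
    apply: le_trans C1 _; rewrite mulrC; apply: ler_wpM2l => //; exact: sqrtr_ge0.
  apply: le_trans C3 _; rewrite mulrC; apply: ler_wpM2l => //; exact: sqrtr_ge0.
have Hv : H1mx Om v.
  by move=> i k; rewrite ord1; split; [exact: Lv|move=> j; eexists; exact: wG].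
exists v => // e e0; have e2 : 0 < e / 2 by exact: divr_gt0.
have [N1 h1] := uv _ e2; have [N2 h2] := uG _ e2.
exists (maxn N1 N2) => n; rewrite geq_max => /andP[n1 n2].
have := h1 n n1; have := h2 n n2; rewrite /H1dot.
have Hnv : H1mx Om (u n - v) by exact: (subspaceB subH1).
have JG : {ae mu, forall x, Om x -> Jac Om (u n - v) x = (Jac Om (u n) - G) x}.
  have J1 := Jac_lin (-1) Hv (Hu n); have J2 := Jac_ae_eq wG.
  apply: filterS2 J1 J2 => x j1 j2 Omx.
  by rewrite addrC -scaleN1r j1// j2// scaleN1r addrC.
have LJnG : L2mx mu Om (Jac Om (u n) - G).
  exact: (subspaceB (subspace_L2mx mu mOm 3 3) (Jac_L2 (Hu n)) LG).
have [sym _ _] := @semi_inner_L2dot _ _ _ mu Om mOm 3 3.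
have LJ := Jac_L2 Hnv.
rewrite -(L2dot_ae_eq mOm LJ LJnG LJnG JG) (sym _ _ LJ LJnG) -(L2dot_ae_eq mOm LJ LJnG LJ JG); lra.
Qed.

End sobolev_spaces.

(** * Coercivity on H^1_0 *)

Section H10_space.
Variables (R : realType) (Om : set (R3 R)).
Hypotheses (oOm : open Om) (bOm : bounded_set Om).
Notation mu := (leb3 R).
Notation e_ := (basis3 R).
Implicit Types (u v w phi : R3 R -> 'cV[R]_3).

Let mOm : measurable Om. Proof. exact: open_measurable3. Qed.
Let subH1 := subspace_H1 oOm.
Let innerH1 := semi_inner_H1dot oOm.
Let innerE := semi_inner_strain oOm.

Lemma testfun_H1 phi : (forall i, testfun Om (fun x => phi x i 0)) -> H1mx Om phi.
Proof.
move=> tphi i k; rewrite ord1; split; first exact: testfun_L2.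
by move=> j; exists ('D_(e_ j) (fun x => phi x i 0)); exact: testfun_is_wpartial.
Qed.

Lemma testfun_Jac phi : (forall i, testfun Om (fun x => phi x i 0)) ->
  {ae mu, forall x, Om x -> Jac Om phi x = classical_Jac phi x}.
Proof.
move=> tphi; apply: Jac_ae_eq => // i j.
under [X in is_wpartial _ _ _ X]eq_fun do rewrite mxE.
exact: testfun_is_wpartial.
Qed.

Lemma H1norm_triangle u v : H1mx Om u -> H1mx Om v ->
  H1norm Om (u + v) <= H1norm Om u + H1norm Om v.
Proof. by move=> Hu Hv; rewrite !H1normE; apply: (semi_inner_triangle subH1 innerH1). Qed.

Lemma H1normZ a u : H1mx Om u -> H1norm Om (a *: u) = `|a| * H1norm Om u.
Proof.
move=> Hu; rewrite !H1normE; have [_ linl _] := innerH1.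
have Hau : H1mx Om (a *: u) by exact: (subspaceZ subH1).
rewrite (linear_onZ subH1 (linl _ Hau))//.
rewrite (linear_onZ subH1 (semi_inner_linr subH1 innerH1 Hu))//.
by rewrite mulrA -expr2 sqrtrM ?sqr_ge0// sqrtr_sqr.
Qed.

Lemma H1normB u v : H1mx Om u -> H1mx Om v ->
  H1norm Om (u - v) <= H1norm Om u + H1norm Om v.
Proof.
move=> Hu Hv; have HNv : H1mx Om (- v).
  by rewrite -scaleN1r; exact: (subspaceZ subH1).
apply: le_trans (H1norm_triangle Hu HNv) _.
by rewrite -[in leLHS]scaleN1r H1normZ// normrN1 mul1r.
Qed.

Lemma H10_approx v e : H10 Om v -> 0 < e -> exists phi,
  (forall i, testfun Om (fun x => phi x i 0)) /\ H1norm Om (v - phi) < e.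
Proof. by move=> [_ Hv] e0; have [phi h] := Hv e e0; exists phi. Qed.

Lemma subspace_H10 : subspace [set v | H10 Om v].
Proof.
split.
  split; first exact: subH1.1.
  move=> e e0; exists 0; split.
    move=> i; rewrite (_ : (fun x => _) = fun=> 0); first exact: testfun0.
    by apply/funext => x; rewrite mxE.
  have -> : (fun x => (0 : R3 R -> 'cV[R]_3) x - (0 : R3 R -> 'cV[R]_3) x) = 0 *: 0.
    by apply/funext => x; rewrite subrr scale0r.
  by rewrite H1normZ ?normr0 ?mul0r//; exact: subH1.1.
move=> a u v Hu Hv; split; first by apply: subH1.2; [exact: Hu.1|exact: Hv.1].
move=> e e0; have e2 : 0 < e / 2 by exact: divr_gt0.
have a1 : 0 < `|a| + 1 by rewrite ltr_wpDl.
have ea : 0 < e / 2 / (`|a| + 1) by exact: divr_gt0.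
have [p [tp up]] := H10_approx Hu ea; have [q [tq vq]] := H10_approx Hv e2.
exists (a *: p + q); split.
  move=> i; rewrite (_ : (fun x => _) = fun x => a * p x i 0 + q x i 0).
    exact: testfun_lin.
  by apply/funext => x; rewrite !mxE.
have -> : (fun x => (a *: u + v) x - (a *: p + q) x) = a *: (u - p) + (v - q).
  apply/funext => x; rewrite -[LHS]/((a *: u + v - (a *: p + q)) x); congr (_ x).
  by rewrite scalerBr opprD addrACA.
have Hup : H1mx Om (u - p) by apply: (subspaceB subH1); [exact: Hu.1|exact: testfun_H1].
have Hvq : H1mx Om (v - q) by apply: (subspaceB subH1); [exact: Hv.1|exact: testfun_H1].
apply: le_lt_trans (H1norm_triangle _ Hvq) _; first exact: (subspaceZ subH1).
rewrite H1normZ//; have -> : e = e / 2 + e / 2 by field.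
apply: ler_ltD => //; apply: (@le_trans _ _ ((`|a| + 1) * (e / 2 / (`|a| + 1)))).
  by apply: ler_pM => //; [exact: sqrtr_ge0|rewrite lerDl|exact: ltW].
by rewrite mulrC divfK// gt_eqF.
Qed.

Lemma semi_inner_H10 : semi_inner [set v | H10 Om v] (H1dot Om).
Proof.
have [s l p] := innerH1.
split=> [u v [Hu _] [Hv _]|w [Hw _] a u v [Hu _] [Hv _]|u [Hu _]].
- exact: s.
- exact: l.
- exact: p.
Qed.

Lemma H10_complete : seq_complete [set v | H10 Om v] (H1dot Om).
Proof.
move=> u Hu uC; have [//|v Hv uv] := H1_complete oOm (fun n => (Hu n).1).
exists v => //; split=> // e e0.
have e2 : 0 < e / 2 by exact: divr_gt0.
have [N NP] := uv _ (exprn_gt0 2 e2).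
have [phi [tphi uphi]] := H10_approx (Hu N) e2.
exists phi; split=> //.
have HN : H1mx Om (u N) := (Hu N).1.
have H1 : H1mx Om (u N - phi) by apply: (subspaceB subH1) => //; exact: testfun_H1.
have H2 : H1mx Om (u N - v) by exact: (subspaceB subH1).
have -> : (fun x => v x - phi x) = (u N - phi) - (u N - v).
  apply/funext => x; rewrite -[LHS]/((v - phi) x); congr (_ x).
  by rewrite opprB [RHS]addrC addrA subrK.
apply: le_lt_trans (H1normB H1 H2) _; have -> : e = e / 2 + e / 2 by field.
apply: ltr_leD uphi _; rewrite H1normE -[leRHS](ger0_norm (ltW e2)) -sqrtr_sqr.
by apply: ler_wsqrtr; apply: ltW; exact: NP.
Qed.

Lemma bounded_coord : exists B, forall j x, Om x -> `|coord j x| <= B.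
Proof.
have [B [rB hB]] := bOm; exists (B + 1) => j x Omx.
apply: le_trans (coord_le_norm j x) _.
by apply: hB => //; rewrite ltrDl.
Qed.

Lemma testfun_coercive : exists2 K, 0 <= K & forall phi,
  (forall i, testfun Om (fun x => phi x i 0)) ->
  H1dot Om phi phi <= K * strain_dot Om phi phi.
Proof.
(* Poincare contributes [4 * B ^+ 2], the gradient term of the norm contributes 1, and Korn the
   factor 2. *)
have [B hB] := bounded_coord; exists ((4 * B ^+ 2 + 1) * 2).
  by have := sqr_ge0 B; lra.
move=> phi tphi; have Hphi := testfun_H1 tphi.
have Lphi : L2mx mu Om phi := H1mx_L2 Hphi.
have LJ := Jac_L2 Hphi; pose J := classical_Jac phi.
have LcJ : L2mx mu Om J.
  move=> i j; under [X in L2 _ _ X]eq_fun do rewrite mxE.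
  by apply: testfun_L2 => //; exact: testfun_D.
have JJ := testfun_Jac tphi.
have [sym3 _ pos3] := @semi_inner_L2dot _ _ _ mu Om mOm 3 3.
have EJ : L2dot mu Om (Jac Om phi) (Jac Om phi) = L2dot mu Om J J.
  rewrite (L2dot_ae_eq mOm LJ LcJ LJ JJ) (sym3 _ _ LcJ LJ).
  exact: (L2dot_ae_eq mOm LJ LcJ LcJ JJ).
have LsJ := sympart_L2 oOm LJ; have LscJ := sympart_L2 oOm LcJ.
have sJJ : {ae mu, forall x, Om x -> sympart (Jac Om phi x) = sympart (J x)}.
  by apply: filterS JJ => x h Omx; rewrite h.
have ES : strain_dot Om phi phi =
    L2dot mu Om (fun x => sympart (J x)) (fun x => sympart (J x)).
  rewrite /strain_dot (L2dot_ae_eq mOm LsJ LscJ LsJ sJJ) (sym3 _ _ LscJ LsJ).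
  exact: (L2dot_ae_eq mOm LsJ LscJ LscJ sJJ).
have korn := korn_testfun mOm tphi; rewrite -/J in korn.
have poincare : L2dot mu Om phi phi <= 4 * B ^+ 2 * L2dot mu Om J J.
  rewrite !L2dot_sum// mulr_sumr; apply: ler_sum => i _.
  rewrite big_ord1 big_ord_recl mulrDr.
  have -> : \int[mu]_(x in Om) (phi x i ord0 * phi x i ord0) =
      \int[mu]_(x in Om) phi x i 0 ^+ 2.
    by apply: eq_Rintegral => x _; rewrite expr2.
  (* Poincare's inequality in the first direction alone suffices; the remaining partial derivatives
     only enlarge the right-hand side. *)
  apply: le_trans (poincare_testfun (hB ord0) (tphi i)) _.
  have -> : \int[mu]_(x in Om) 'D_(e_ ord0) (fun x => phi x i 0) x ^+ 2 =
      \int[mu]_(x in Om) (J x i ord0 * J x i ord0).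
    by apply: eq_Rintegral => x _; rewrite mxE expr2.
  have B20 : 0 <= 4 * B ^+ 2 by apply: mulr_ge0 => //; exact: sqr_ge0.
  rewrite lerDl; apply: mulr_ge0 B20 _.
  by apply: sumr_ge0 => k _; apply: Rintegral_ge0 => x _; rewrite -expr2 sqr_ge0.
have B0 : 0 <= 4 * B ^+ 2 + 1 by have := sqr_ge0 B; lra.
have := ler_wpM2l B0 korn; rewrite /H1dot EJ ES -mulrA => korn'.
by apply: le_trans korn'; rewrite mulrDl mul1r lerD2r.
Qed.

(** The closure argument is run on norms instead of squares, where the triangle inequality applies
    to both sides. The [+ 1] in [K] makes [K ^- 2] positive. *)
Lemma H10_coercive : exists2 c, 0 < c & forall v, H10 Om v ->
  c * H1dot Om v v <= strain_dot Om v v.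
Proof.
have [K0 K00 hK] := testfun_coercive; pose K := Num.sqrt K0 + 1.
have K1 : 1 <= K by rewrite lerDr sqrtr_ge0.
have Kgt : 0 < K by exact: lt_le_trans K1.
exists (K ^- 2); first by rewrite invr_gt0 exprn_gt0.
move=> v Hv; have Hv1 : H1mx Om v := Hv.1.
have [_ _ posE] := innerE; have [_ _ posH] := innerH1.
have sE w : H1mx Om w -> Num.sqrt (strain_dot Om w w) <= H1norm Om w.
  by move=> Hw; rewrite H1normE ler_wsqrtr// strain_le_H1dot.
(* Of the error, [e] is the distance from [v] to [phi], and [K * e] comes from replacing the strain
   of [phi] by that of [v]. *)
have step e : 0 < e -> H1norm Om v <= K * Num.sqrt (strain_dot Om v v) + (1 + K) * e.
  move=> e0; have [phi [tphi vphi]] := H10_approx Hv e0.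
  have Hphi := testfun_H1 tphi.
  have Hd : H1mx Om (v - phi) by exact: (subspaceB subH1).
  have t1 : H1norm Om v <= H1norm Om (v - phi) + H1norm Om phi.
    by rewrite -{1}[v](subrK phi); exact: H1norm_triangle.
  have t2 : H1norm Om phi <= K * Num.sqrt (strain_dot Om phi phi).
    rewrite H1normE; apply: (@le_trans _ _ (Num.sqrt K0 * Num.sqrt (strain_dot Om phi phi))).
      by rewrite -sqrtrM// ler_wsqrtr// hK.
    by apply: ler_wpM2r; [exact: sqrtr_ge0|rewrite /K lerDl].
  have t3 : Num.sqrt (strain_dot Om phi phi) <=
      Num.sqrt (strain_dot Om v v) + Num.sqrt (strain_dot Om (v - phi) (v - phi)).
    have Hd' : H1mx Om (phi - v) by exact: (subspaceB subH1).
    have := semi_inner_triangle subH1 innerE Hv1 Hd'; rewrite addrC subrK.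
    by rewrite -(semi_inner_sqN subH1 innerE Hd') opprB.
  have t4 := sE _ Hd.
  have t5 : Num.sqrt (strain_dot Om phi phi) <= Num.sqrt (strain_dot Om v v) + e.
    by apply: le_trans t3 _; rewrite lerD2l; exact: le_trans t4 (ltW vphi).
  have t6 := le_trans t2 (ler_wpM2l (ltW Kgt) t5).
  apply: le_trans t1 _; apply: (le_trans (lerD (ltW vphi) t6)).
  move: (Num.sqrt _) => r; rewrite le_eqVlt; apply/orP; left; apply/eqP; ring.
have main : H1norm Om v <= K * Num.sqrt (strain_dot Om v v).
  apply/ler_addgt0Pr => e e0.
  have K2 : 0 < 1 + K by lra.
  have E : (1 + K) * (e / (1 + K)) = e by field; rewrite gt_eqF.
  by have := step _ (divr_gt0 e0 K2); rewrite E.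
rewrite mulrC ler_pdivrMr ?exprn_gt0//.
rewrite -[leLHS]sqr_sqrtr; last exact: posH.
rewrite -[X in _ <= X * _]sqr_sqrtr; last exact: posE.
rewrite -H1normE -exprMn mulrC; apply: lerXn2r => //; rewrite nnegrE.
  by rewrite H1normE sqrtr_ge0.
by rewrite mulr_ge0 ?sqrtr_ge0// ltW.
Qed.

End H10_space.

(** * Time slices of square integrable fields *)

Section time_slice.
Variable R : realType.
Notation lam := (@lebesgue_measure R).

(* Same device as leb2. *)
Definition leb3_sf : set (R3 R) -> \bar R := leb3 R.

HB.instance Definition _ := Measure.on leb3_sf.

Let leb3_sf_sigma_finite : sigma_finite setT leb3_sf.
Proof.
exists (fun n : nat => cbox (cube (- n%:R)) (cube (n%:R : R))).
  apply/esym; rewrite -subTset => x _; have [n xn] := cube_cover x; exists n => // j.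
  by rewrite !coord_cube -ler_norml ltW.
by move=> n; split; [exact: measurable_cbox|exact: leb3_cbox_lty].
Qed.

HB.instance Definition _ := Measure_isSigmaFinite.Build _ _ _ leb3_sf leb3_sf_sigma_finite.

(** Fubini for the square of the extension by zero: for [t] in [I], the slice of that extension is
    the extension by zero of the slice off [Om]. *)
Lemma L2_slice (Om : set (R3 R)) (I : set (measurableTypeR R))
    (f : R3 R * measurableTypeR R -> R) :
  L2 (leb3 R \x lam)%E (Om `*` I) f ->
  {ae lam, forall t, I t -> L2 (leb3 R) Om (fun x => f (x, t))}.
Proof.
rewrite /L2; set F := f \_ (Om `*` I) => LF.
have mF : measurable_fun setT F by exact: set_mem (sub_Lfun_mfun LF).
have IF : (leb3_sf \x lam)%E.-integrable setT (EFin \o (fun x => F x ^+ 2)).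
  exact: Lfun2_integrable_sqr LF.
have := ae_integrable2 IF; apply: filterS => t Ft It.
have -> : (fun x => f (x, t)) \_ Om = (fun x => F (x, t)) \_ setT.
  apply/funext => x; rewrite !patchE in_setT /F patchE.
  by congr (if _ then _ else _); apply/idP/idP => /set_mem h; apply/mem_set => //; case: h.
apply/(L2P (leb3 R) measurableT); split; last exact: Ft.
exact: measurable_fun_pair1 mF.
Qed.

Lemma L2mx_slice m n (Om : set (R3 R)) (I : set (measurableTypeR R))
    (g : R3 R * measurableTypeR R -> 'M[R]_(m, n)) :
  L2mx (leb3 R \x lam)%E (Om `*` I) g ->
  {ae lam, forall t, I t -> L2mx (leb3 R) Om (fun x => g (x, t))}.
Proof.
move=> Lg.
have : {ae lam, forall t, forall p : 'I_m * 'I_n, I t ->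
    L2 (leb3 R) Om (fun x => g (x, t) p.1 p.2)}.
  by apply: filter_forall => -[i j]; exact: L2_slice (Lg i j).
by apply: filterS => t h It i j; exact: (h (i, j) It).
Qed.

End time_slice.

(** * The operator A(sigma) *)

Section elliptic_operator.
Variables (R : realType) (Om : set (R3 R)) (H : 'M[R]_3 -> 'M[R]_3 -> 'M[R]_3)
  (sigma : R3 R -> 'M[R]_3).
Hypotheses (oOm : open Om) (bOm : bounded_set Om) (H_map : stiffness_map H)
  (sigma_sym : \forall x \ae leb3 R, Om x -> sigma x \is symmetricmx)
  (A_op : opA_linear_operator Om H sigma) (H_pos : positive_definite H).
Notation mu := (leb3 R).
Notation A := (opA Om H sigma).

Let mOm : measurable Om. Proof. exact: open_measurable3. Qed.
Let subH := subspace_H10 oOm.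
Let innerH := semi_inner_H10 oOm.

(** [H] maps the strain to a symmetric matrix a.e., so the Jacobian in the second slot may be
    replaced by the strain. Positive definiteness then gives [c0], and Korn with Poincare gives
    [c1]. *)
Lemma opA_coercive : exists2 c, 0 < c & forall v, H10 Om v ->
  c * H1dot Om v v <= A v v.
Proof.
have [c0 [c0_gt0 Hc0]] := H_pos; have [c1 c1_gt0 Hc1] := H10_coercive oOm bOm.
exists (c0 * c1); first exact: mulr_gt0.
move=> v Hv; have [Ai _ _] := A_op; have LJ := Jac_L2 Hv.1.
have LsJ := sympart_L2 oOm LJ; have IsJ := L2mx_integrable_frob mOm LsJ LsJ.
rewrite -mulrA; apply: (@le_trans _ _ (c0 * strain_dot Om v v)).
  by rewrite ler_pM2l// Hc1.
rewrite /opA /wDiv opprK /strain_dot /L2dot -RintegralZl//.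
apply: (Rintegral_ae_le mOm (integrableZl mOm _ IsJ) (Ai v v Hv Hv)).
apply: filterS sigma_sym => x sx Omx; have {}sx := sx Omx.
have sJ := sympart_sym (Jac Om v x); have [Hsym _ _] := H_map.
by rewrite -(frob_sympart _ (Hsym _ _ sx sJ)) -fnorm_sqr Hc0.
Qed.

Let A_linr v : H10 Om v -> linear_on [set v | H10 Om v] (A v).
Proof. by move=> Hv; have [_ h _] := A_op; have [l _] := h v Hv. Qed.

Let A_linl w : H10 Om w -> linear_on [set v | H10 Om v] (A ^~ w).
Proof. by move=> Hw a u v Hu Hv; have [_ _ h] := A_op; exact: (h a u v Hu Hv w Hw). Qed.

Lemma H1dot_eq0 v : H10 Om v -> H1dot Om v v = 0 -> {ae mu, forall x, Om x -> v x = 0}.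
Proof.
move=> Hv v0; have Lv := H1mx_L2 Hv.1.
have ge : 0 <= L2dot mu Om v v by apply: Rintegral_ge0 => x _; exact: frob_ge0.
have le : L2dot mu Om v v <= 0 by rewrite -[leRHS]v0; exact: L2dot_le_H1dot Hv.1.
have e : L2dot mu Om v v = 0 by apply/eqP; rewrite eq_le le ge.
by have := L2dot_eq0 mOm Lv e; apply: filterS => x h Omx; exact: h.
Qed.

(** Contraposed, this is strict monotonicity; when the difference vanishes, it is uniqueness of weak
    solutions. *)
Lemma opA_diff_le0 v1 v2 : H10 Om v1 -> H10 Om v2 ->
  A v1 (v1 - v2) - A v2 (v1 - v2) <= 0 -> v1 = v2 %[ae mu in Om].
Proof.
move=> H1 H2 le0; have Hd : H10 Om (v1 - v2) := subspaceB subH H1 H2.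
have [c c_gt0 coer] := opA_coercive.
have E : A (v1 - v2) (v1 - v2) = A v1 (v1 - v2) - A v2 (v1 - v2) :=
  linear_onB (A_linl Hd) H1 H2.
have d0 : H1dot Om (v1 - v2) (v1 - v2) = 0.
  have [_ _ pos] := innerH; apply/eqP; rewrite eq_le pos// andbT.
  rewrite -(ler_pM2l c_gt0) mulr0; apply: le_trans (coer _ Hd) _.
  by rewrite E.
have := H1dot_eq0 Hd d0; apply: filterS => x h Omx.
by apply/eqP; rewrite -subr_eq0; apply/eqP; exact: h.
Qed.

Lemma opA_strictly_monotone : strictly_monotone Om A.
Proof.
move=> v1 v2 H1 H2 v12; rewrite ltNge; apply/negP => le0; apply: v12.
exact: opA_diff_le0.
Qed.

Lemma weak_solution_exists (f : R3 R -> 'cV[R]_3) : L2mx mu Om f ->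
  exists v, weak_solution Om H sigma f v.
Proof.
move=> Lf; have [c c_gt0 coer] := opA_coercive.
have [_ Abnd _] := A_op.
have [_ linf _] := @semi_inner_L2dot _ _ _ mu Om mOm 3 1.
have sub1 := subspace_L2mx mu mOm 3 1; have inner1 := semi_inner_L2dot mu mOm 3 1.
have lin : linear_on [set v | H10 Om v] (L2functional Om f).
  move=> a u v Hu Hv.
  exact: (semi_inner_linr sub1 inner1 Lf) (H1mx_L2 Hu.1) (H1mx_L2 Hv.1).
have bnd : bounded_on [set v | H10 Om v] (H1dot Om) (L2functional Om f).
  exists (Num.sqrt (L2dot mu Om f f)) => w Hw; have Lw := H1mx_L2 Hw.1.
  apply: (le_trans (semi_inner_CS_sqrt sub1 inner1 Lf Lw)).
  apply: ler_wpM2l; first exact: sqrtr_ge0.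
  by apply: ler_wsqrtr; exact: (L2dot_le_H1dot oOm Hw.1).
(* The constant [C] depends on [v]: it is the norm of the single functional [A v] that membership in
   $H^{-1}$ supplies. *)
have Abd v : H10 Om v -> bounded_on [set v | H10 Om v] (H1dot Om) (A v).
  move=> Hv; have [_ [C hC]] := Abnd v Hv; exists C => w Hw.
  by rewrite -H1normE; exact: hC.
have [v Hv Av] := lax_milgram subH innerH (H10_complete oOm) c_gt0 A_linl A_linr
  Abd coer lin bnd.
by exists v; split.
Qed.

Lemma weak_solution_unique (f : R3 R -> 'cV[R]_3) v v' :
  weak_solution Om H sigma f v -> weak_solution Om H sigma f v' ->
  v' = v %[ae mu in Om].
Proof.
move=> [Hv Ev] [Hv' Ev']; apply: opA_diff_le0 => //.
have Hd : H10 Om (v' - v) := subspaceB subH Hv' Hv.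
by rewrite Ev// Ev'// subrr.
Qed.

End elliptic_operator.
Theorem theorem2p8 (R : realType) (Om : set (R3 R)) (T : \bar R)
    (H : 'M[R]_3 -> 'M[R]_3 -> 'M[R]_3)
    (sigma W : R -> R3 R -> 'M[R]_3)
    (Om_domain : is_domain Om) (Om_bounded : bounded_set Om)
    (T_gt0 : (0 < T)%E)
    (H_smooth : stiffness_map H)
    (sigma_H1 : forall t, time_interval T t -> H1mx Om (sigma t) /\
       \forall x \ae leb3 R, Om x -> sigma t x \is symmetricmx)
    (W_H1 : forall t, time_interval T t -> H1mx Om (W t) /\
       \forall x \ae leb3 R, Om x -> W t x \is skewmx)
    (A_operator : forall t, time_interval T t ->
       opA_linear_operator Om H (sigma t))
    (H_posdef : positive_definite H) :
  (forall t, time_interval T t ->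
     strictly_monotone Om (opA Om H (sigma t)))
  /\
  (forall g : R3 R * measurableTypeR R -> 'cV[R]_3,
     L2mx (leb3 R \x @lebesgue_measure R)%E (Om `*` time_interval T) g ->
     \forall t \ae @lebesgue_measure R, time_interval T t ->
       exists v, weak_solution Om H (sigma t) (fun x => g (x, t)) v /\
         forall v', weak_solution Om H (sigma t) (fun x => g (x, t)) v' ->
           v' = v %[ae leb3 R in Om]).
Proof.
have [oOm _ _] := Om_domain; split=> [t tT|g Lg].
  by apply: opA_strictly_monotone => //; [exact: (sigma_H1 t tT).2|exact: A_operator].
have := L2mx_slice Lg; apply: filterS => t Lgt tT.
have sym := (sigma_H1 t tT).2; have A_op := A_operator t tT.
have [v vP] := weak_solution_exists oOm Om_bounded H_smooth sym A_op H_posdef (Lgt tT).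
by exists v; split=> // v'; exact: (weak_solution_unique oOm Om_bounded H_smooth sym A_op H_posdef).
Qed.
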